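(* Let $T>0$, let $(X_\alpha)_{\alpha\in[0,2)}$, $A$ and $(S(t))_{t\ge 0}$ satisfy the structural assumptions listed in the context, let $x\in C^\eta([0,T])$ for some $\eta\in(1/2,1)$, let $\alpha\in(0,1)$ be such that $\alpha+\eta>1$, let $\sigma:X\to X$ satisfy the assumptions on $\sigma$ listed in the context with this $\alpha$, and let $\psi\in X_\alpha$. Let $y$ be the unique mild solution to $$dy(t)=Ay(t)\,dt+\sigma(y(t))\,dx(t),\quad t\in(0,T],\qquad y(0)=\psi .$$ Then $y$ satisfies the integral equation $$y(t)=\psi+\int_0^tAy(u)\,du+\int_0^t\sigma(y(u))\,dx(u),\qquad t\in[0,T].$$
   Context: Structural assumptions. $X$ is a Banach space and $A:D(A)\subseteq X\to X$ is a linear operator which generates a semigroup $(S(t))_{t\ge0}$ of bounded linear operators on $X$, strongly continuous on $(0,\infty)$ (no strong continuity at $t=0$ is required; a typical example is the analytic semigroup generated by a sectorial operator). For every $\alpha\in[0,2)$ there is a (Banach) space $X_\alpha$, with norm $|\cdot|_\alpha$, with $X_0=X$ and $X_1=D(A)$, such that $X_\alpha$ is continuously embedded into $X_\beta$ if $\beta\le\alpha$. For every $T>0$: (a) for all $\zeta,\alpha\in[0,2)$ with $\zeta\le\alpha$ there is a constant $M_{\zeta,\alpha,T}>0$ with $\|S(t)\|_{\mathscr L(X_\zeta,X_\alpha)}\le M_{\zeta,\alpha,T}\,t^{-\alpha+\zeta}$ for $t\in(0,T]$; (b) for all $\mu,\nu\in[0,1]$ with $\mu>\nu$ there is a constant $C_{\mu,\nu,T}>0$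 with $\|S(t)-I\|_{\mathscr L(X_\mu,X_\nu)}\le C_{\mu,\nu,T}\,t^{\mu-\nu}$ for $t\in(0,T]$. Function spaces. $[a,b]^2_<=\{(s,t)\in\mathbb R^2:a\le s<t\le b\}$. For $f\in C([a,b];X)$ put $(\hat\delta_1 f)(s,t)=f(t)-f(s)-(S(t-s)-I)f(s)=f(t)-S(t-s)f(s)$. For $\alpha,\beta\in[0,2)$, $C_\beta([a,b]^2_<;X_\alpha)$ is the space of $f\in C([a,b]^2_<;X_\alpha)$ with $\|f\|_{\beta|\alpha,[a,b]}:=\sup_{(s,t)\in[a,b]^2_<}|f(s,t)|_\alpha/|t-s|^\beta<\infty$, and $\hat C_\beta([a,b];X_\alpha)$ is the set of $f\in C([a,b];X_\alpha)$ with $\hat\delta_1f\in C_\beta([a,b]^2_<;X_\alpha)$. $C^\eta([a,b])$ is the space of real $\eta$-Hölder continuous functions. Young integrals. Let $x\in C^\eta([a,b])$, $(s,t)\in[a,b]^2_<$, and let $\Pi=\{s=t_0<\dots<t_n=t\}$ denote partitions of mesh $|\Pi|$. If $f\in C^{\alpha}([a,b];X)$ with $\alpha\in(1-\eta,1)$, then $\int_s^tf(u)\,dx(u):=\lim_{|\Pi|\to0}\sum_{i=0}^{n-1}f(t_i)(x(t_{i+1})-x(t_i))$. If $f\in\hat C_k([a,b];X_\beta)$ with $\beta\in[0,2)$ and $\eta+k>1$, then $\mathscr I_{Sf}(s,t)=\int_s^tS(t-r)f(r)\,dx(r):=\lim_{|\Pi|\to0}\sum_{i=0}^{n-1}S(t-t_i)f(t_i)(x(t_{i+1})-x(t_i))$.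 Both limits (in $X$) are known to exist; the integrals are $0$ if $s=t$. For $y\in\hat C_\alpha([0,T];X_\alpha)$ with $\alpha\in(1-\eta,1)$ one has $\sigma(y)\in C^\alpha([0,T];X)$, so $\int_0^t\sigma(y(u))\,dx(u)$ is well defined. Assumptions on $\sigma$ (with parameter $\alpha$). $\sigma:X\to X$ is Fréchet differentiable with bounded and locally Lipschitz continuous Fréchet derivative; the restriction of $\sigma$ to $X_\alpha$ maps $X_\alpha$ into itself, is locally Lipschitz continuous on $X_\alpha$, and there is a constant $L_\sigma^\alpha>0$ with $|\sigma(z)|_\alpha\le L_\sigma^\alpha(1+|z|_\alpha)$ for $z\in X_\alpha$. Here ''locally Lipschitz'' means Lipschitz on every bounded set. Mild solution. A mild solution is a function $y:[0,T]\to X$ such that $\sigma(y)\in\hat C_\alpha([0,T];X)$ (with $\eta+\alpha>1$) and $y(t)=S(t)\psi+\mathscr I_{S\sigma(y)}(0,t)$ for every $t\in[0,T]$; ''the unique mild solution'' is the unique mild solution belonging to $\hat C_\alpha([0,T];X_\alpha)$. *)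

(* Defs.v *)
From Stdlib Require Import Reals.
From Coquelicot Require Import Coquelicot.
Set Implicit Arguments.
Unset Strict Implicit.
Open Scope R_scope.

(** Conventions.  Partially defined objects are total functions read only on
    their domain: an operator on [X] is a function [A : X -> X] used on a
    predicate [DA : X -> Prop], a semigroup is [Sg : R -> X -> X] used at times
    [0 <= t], and the scale [(X_a)] is a family of predicates [Xs : R -> X -> Prop]
    with functions [nrm : R -> X -> R], where [nrm a] is used on [Xs a] only.
    The powers [Rpower] below are only taken at positive bases. *)

Section Operators.

Variable X : CompleteNormedModule R_AbsRing.
Implicit Types (DA E : X -> Prop) (N : X -> R) (A : X -> X) (Sg : R -> X -> X).

Record linear_subspace E : Prop := {
  subspace_zero : E zero;
  subspace_plus : forall u v, E u -> E v -> E (plus u v);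
  subspace_scal : forall (c : R) u, E u -> E (scal c u) }.

Record linear_operator DA A : Prop := {
  operator_domain : linear_subspace DA;
  operator_plus : forall u v, DA u -> DA v -> A (plus u v) = plus (A u) (A v);
  operator_scal : forall (c : R) u, DA u -> A (scal c u) = scal c (A u) }.

Record semigroup Sg : Prop := {
  semigroup_bounded : forall t, 0 <= t -> is_linear (Sg t);
  semigroup_0 : forall z, Sg 0 z = z;
  semigroup_plus : forall s t z, 0 <= s -> 0 <= t -> Sg (s + t) z = Sg s (Sg t z);
  (* no continuity is asked at 0 *)
  semigroup_continuous : forall z t, 0 < t -> continuous (fun r => Sg r z) t }.

(** Generator of a semigroup which may fail to be strongly continuous at [0],
    defined by its resolvent being the Laplace transform of the semigroup: for
    [l] large, [l - A : D(A) -> X] is bijective and its inverse maps [z] to the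
    integral over (0,+oo) of [exp (- l r) S(r) z].  (The derivative at [0] would
    not do: for a sectorial operator with non-dense domain it is only the part of
    [A] in the closure of [D(A)].) *)
Definition generates DA A Sg : Prop :=
  exists w : R, forall l : R, w < l -> forall z : X, exists Rz : X,
    is_RInt_gen (fun r => scal (exp (- (l * r))) (Sg r z))
                (at_right 0) (Rbar_locally p_infty) Rz /\
    (forall v : X, (DA v /\ minus (scal l v) (A v) = z) <-> v = Rz).

Record banach_subspace E N : Prop := {
  banach_subspace_linear : linear_subspace E;
  banach_norm_plus : forall u v, E u -> E v -> N (plus u v) <= N u + N v;
  banach_norm_scal : forall (c : R) u, E u -> N (scal c u) = Rabs c * N u;
  banach_norm_eq0 : forall u, E u -> N u = 0 -> u = zero;
  banach_complete : forall u : nat -> X,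
    (forall n, E (u n)) ->
    (forall eps, 0 < eps -> exists n0 : nat, forall n m : nat,
       (n0 <= n)%nat -> (n0 <= m)%nat -> N (minus (u n) (u m)) < eps) ->
    exists z, E z /\ is_lim_seq (fun n => N (minus (u n) z)) 0 }.

Record structural_assumptions DA A Sg (Xs : R -> X -> Prop) (nrm : R -> X -> R)
    : Prop := {
  sa_operator : linear_operator DA A;
  sa_semigroup : semigroup Sg;
  sa_generates : generates DA A Sg;
  sa_banach : forall a, 0 <= a < 2 -> banach_subspace (Xs a) (nrm a);
  sa_X0 : forall z, Xs 0 z /\ nrm 0 z = norm z;
  sa_X1 : forall z, Xs 1 z <-> DA z;
  (* [X_1] is [D(A)] as a Banach space, i.e. with the topology of the graph norm *)
  sa_X1_norm : exists c, 0 < c /\ forall z, DA z ->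
    nrm 1 z <= c * (norm z + norm (A z)) /\ norm z + norm (A z) <= c * nrm 1 z;
  sa_embedding : forall a b, 0 <= b -> b <= a -> a < 2 -> exists c, 0 < c /\
    forall z, Xs a z -> Xs b z /\ nrm b z <= c * nrm a z;
  sa_smoothing : forall T, 0 < T -> forall zeta a, 0 <= zeta -> zeta <= a -> a < 2 ->
    exists M, 0 < M /\ forall t, 0 < t <= T -> forall v, Xs zeta v ->
      Xs a (Sg t v) /\ nrm a (Sg t v) <= M * Rpower t (- a + zeta) * nrm zeta v;
  sa_increment : forall T, 0 < T -> forall m n, 0 <= n -> n < m -> m <= 1 ->
    exists C, 0 < C /\ forall t, 0 < t <= T -> forall v, Xs m v ->
      nrm n (minus (Sg t v) v) <= C * Rpower t (m - n) * nrm m v }.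

End Operators.

Section FunctionSpaces.

Variable X : CompleteNormedModule R_AbsRing.
Variables (Sg : R -> X -> X) (Xs : R -> X -> Prop) (nrm : R -> X -> R).

(** [f] is continuous from [D] to [X_a]. *)
Definition continuous_into (U : UniformSpace) (D : U -> Prop) (a : R) (f : U -> X)
    : Prop :=
  forall u, D u -> Xs a (f u) /\
    filterlim (fun v => nrm a (minus (f v) (f u))) (within D (locally u)) (locally 0).

Definition interval (a b : R) (u : R) : Prop := a <= u <= b.

Definition simplex (a b : R) (p : R * R) : Prop := a <= fst p < snd p /\ snd p <= b.

Definition C2_space (k c a b : R) (g : R * R -> X) : Prop :=
  continuous_into (simplex a b) c g /\
  exists M, forall p, simplex a b p -> nrm c (g p) / Rpower (snd p - fst p) k <= M.

Definition delta_hat (f : R -> X) (p : R * R) : X :=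
  minus (f (snd p)) (Sg (snd p - fst p) (f (fst p))).

Definition C_hat (k c a b : R) (f : R -> X) : Prop :=
  continuous_into (interval a b) c f /\ C2_space k c a b (delta_hat f).

End FunctionSpaces.

Definition holder (k a b : R) (x : R -> R) : Prop :=
  exists M, forall s t, a <= s -> s < t -> t <= b ->
    Rabs (x t - x s) <= M * Rpower (t - s) k.

Section Integrals.

Variable X : CompleteNormedModule R_AbsRing.

(** [s = p 0 < p 1 < ... < p n = t]; if [s = t] then necessarily [n = 0]. *)
Definition is_partition (s t : R) (n : nat) (p : nat -> R) : Prop :=
  p 0%nat = s /\ p n = t /\ forall i : nat, (i < n)%nat -> p i < p (S i).

Definition mesh_lt (d : R) (n : nat) (p : nat -> R) : Prop :=
  forall i : nat, (i < n)%nat -> p (S i) - p i < d.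

Definition young_sum (x : R -> R) (f : R -> X) (n : nat) (p : nat -> R) : X :=
  sum_n_m (fun i => scal (x (p i) - x (p (pred i))) (f (p (pred i)))) 1 n.

(** [I] is the integral of [f] against [dx] over [s,t].  The convolution
    [I_{Sf} (s,t)] is the case of the integrand [fun r => Sg (t - r) (f r)]. *)
Definition is_young_int (x : R -> R) (f : R -> X) (s t : R) (I : X) : Prop :=
  forall eps, 0 < eps -> exists d, 0 < d /\
    forall n p, is_partition s t n p -> mesh_lt d n p ->
      norm (minus (young_sum x f n p) I) < eps.

(** [I] is the integral over [a,b] of a function continuous on (a,b], possibly
    singular at [a], with integrable norm.  For such functions the improper Riemann
    integral is absolutely convergent and coincides with the Bochner integral. *)
Definition is_int_singular (f : R -> X) (a b : R) (I : X) : Prop :=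
  (a = b /\ I = zero) \/
  (a < b /\
   (forall u, a < u <= b ->
      filterlim f (within (fun v => a < v <= b) (locally u)) (locally (f u))) /\
   ex_RInt_gen (fun u => norm (f u)) (at_right a) (at_point b) /\
   is_RInt_gen f (at_right a) (at_point b) I).

End Integrals.

Section YoungEquation.

Variable X : CompleteNormedModule R_AbsRing.
Variables (Sg : R -> X -> X) (Xs : R -> X -> Prop) (nrm : R -> X -> R).

Record sigma_assumptions (a : R) (sigma : X -> X) : Prop := {
  (* [Ds z] is the Fréchet derivative of [sigma] at [z] *)
  sigma_derivative : exists Ds : X -> X -> X,
    (forall z, filterdiff sigma (locally z) (Ds z)) /\
    (exists M, forall z h, norm (Ds z h) <= M * norm h) /\
    (forall r, exists L, forall z1 z2, norm z1 <= r -> norm z2 <= r ->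
       forall h, norm (minus (Ds z1 h) (Ds z2 h)) <= L * norm (minus z1 z2) * norm h);
  sigma_stable : forall z, Xs a z -> Xs a (sigma z);
  sigma_locally_lipschitz : forall r, exists L, forall z1 z2,
    Xs a z1 -> Xs a z2 -> nrm a z1 <= r -> nrm a z2 <= r ->
    nrm a (minus (sigma z1) (sigma z2)) <= L * nrm a (minus z1 z2);
  sigma_growth : exists L, 0 < L /\ forall z, Xs a z ->
    nrm a (sigma z) <= L * (1 + nrm a z) }.

Definition mild_solution (T a : R) (x : R -> R) (sigma : X -> X) (psi : X)
    (y : R -> X) : Prop :=
  C_hat Sg Xs nrm a 0 0 T (fun t => sigma (y t)) /\
  forall t, 0 <= t <= T -> exists I : X,
    is_young_int x (fun r => Sg (t - r) (sigma (y r))) 0 t I /\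
    y t = plus (Sg t psi) I.

End YoungEquation.

(* Main.v *)
Require Import Defs.
From Corelib Require Import ssreflect.
From Stdlib Require Import Reals Lra Lia.
From Coquelicot Require Import Coquelicot.
Open Scope R_scope.

(** Write [f = sigma(y)].  The nonlinearity enters only through three properties of
    [f]: it is bounded in [X_alpha], [f(t) - S(t-s) f(s)] is [O((t-s)^alpha)] in [X],
    and [y] is the mild solution of the linear equation forced by [f dx].  So the
    result is proved for an abstract forcing [f]
    ([forced_solution_integral_equation]) and then specialised.

    The central object is the flow defect [D(s,t) = y(t) - S(t-s) y(s)], which is the
    convolution of [S] with [f dx] over [s,t].  It has two properties, with
    [gamma = alpha + eta - 1 > 0].

    - In [X] it is [f(s) (x(t) - x(s))] up to [O((t-s)^(1+gamma))].  It is the limit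
      of sums over dyadic partitions ([flow_defect_limit]), and halving an interval
      changes these sums by [O(length^(alpha+eta))] ([dyadic_sum_step]), which is
      summable over all levels ([flow_defect_sewing]).
    - It lies in [X_1 = D(A)] with norm [O((t-s)^gamma)] ([flow_defect_X1]): along
      points [u_k] that halve the distance to [t], [D(s,t)] telescopes into the
      vectors [S(t-u_(k+1)) D(u_k,u_(k+1))], each smoothed by the semigroup, and these
      form a geometric series in [X_1].

    With [s = 0] the second property and the smoothing of [S(t) y(0)] give [y(t)] in
    [D(A)] and [|A y(t)| = O(t^(alpha-1))], so [A y] has a primitive [G] on (0,T] that vanishes at
    [0].  For positive times the derivative of [S(t) v] is [A S(t) v]
    ([orbit_derivative]); as [A y(u) = A S(u-s) y(s) + A D(s,u)], integrating gives
    [G(t) - G(s) = S(t-s) y(s) - y(s) + O((t-s)^(1+gamma))].  Together with the first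
    property, [H = y - G] satisfies
    [H(t) - H(s) = f(s) (x(t) - x(s)) + O((t-s)^(1+gamma))].

    Summing this over a partition, the errors vanish with the mesh.  Hence the Young
    sums of [f] over [0,t] converge, and their limit is [H(t) - H(0)]
    ([young_integral_of_increments]): the existence of the Young integral and the
    integral equation come out of the same estimate. *)

(** * Identities in abelian groups and bounds of norms *)

Lemma cancel_step {G : AbelianGroup} (t r r' : G) :
  r = plus (opp t) r' -> r' = zero -> plus t r = zero.
Proof. move=> -> ->. rewrite plus_zero_r. apply plus_opp_r. Qed.

Lemma pull_deep {G : AbelianGroup} (x a b c : G) :
  b = plus x c -> plus a b = plus x (plus a c).
Proof. move=> ->. by rewrite !plus_assoc (plus_comm a x). Qed.

Lemma eq_of_difference {G : AbelianGroup} (a b : G) :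
  plus a (plus (opp b) zero) = zero -> a = b.
Proof.
  rewrite plus_zero_r => H. apply (plus_reg_r (opp b)).
  by rewrite H plus_opp_r.
Qed.

Ltac pull :=
  first [ reflexivity | eapply pull_deep; pull ].

Ltac cancel_terms :=
  lazymatch goal with
  | |- plus _ _ = zero =>
      eapply cancel_step; [ rewrite ?opp_opp; pull | cancel_terms ]
  | |- _ => reflexivity
  end.

(** Everything is moved to one side; each head term is then cancelled against an
    occurrence of its opposite. *)
Ltac abelian :=
  apply eq_of_difference; rewrite /minus;
  rewrite ?(opp_plus, opp_opp, opp_zero);
  rewrite -?plus_assoc ?plus_zero_l;
  cancel_terms.

Section Norms.
Variable V : CompleteNormedModule R_AbsRing.

Lemma norm_plus_le (a b : V) : norm (plus a b) <= norm a + norm b.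
Proof. apply: norm_triangle. Qed.

Lemma norm_opp_eq (a : V) : norm (opp a) = norm a.
Proof. apply: norm_opp. Qed.

Lemma norm_opp_bound (a : V) (x : R) : norm a <= x -> norm (opp a) <= x.
Proof. by rewrite norm_opp_eq. Qed.

(** These bounds take the estimates of the parts as premises, so that they combine by
    unification. *)
Lemma norm_plus_bound (a b : V) (x y : R) :
  norm a <= x -> norm b <= y -> norm (plus a b) <= x + y.
Proof. move=> Ha Hb. have := norm_plus_le a b. lra. Qed.

Lemma norm_minus_bound (a b : V) (x y : R) :
  norm a <= x -> norm b <= y -> norm (minus a b) <= x + y.
Proof. move=> Ha Hb. apply: norm_plus_bound => //. by apply: norm_opp_bound. Qed.

Lemma norm_scal_bound (c k : R) (a : V) (x : R) :
  Rabs c <= k -> norm a <= x -> norm (scal c a) <= k * x.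
Proof.
  move=> Hc Ha. apply: Rle_trans (norm_scal c a) _.
  apply: Rmult_le_compat => //; first by apply: Rabs_pos. by apply: norm_ge_0.
Qed.

Lemma norm_minus_sym (a b : V) : norm (minus a b) = norm (minus b a).
Proof. rewrite -norm_opp_eq. f_equal. abelian. Qed.

Lemma eq_of_norm_small (a b : V) :
  (forall eps, 0 < eps -> norm (minus a b) <= eps) -> a = b.
Proof.
  move=> H.
  have Hz : minus a b = zero.
  { apply: norm_eq_zero. apply Rle_antisym; last by apply: norm_ge_0.
    apply le_epsilon => eps He. have := H eps He. lra. }
  apply eq_of_difference. rewrite plus_zero_r. exact Hz.
Qed.

Lemma locally_norm_small (l : V) (eps : R) :
  0 < eps -> locally l (fun z => norm (minus z l) < eps).
Proof.
  move=> He.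
  apply (locally_le_locally_norm l (fun z => norm (minus z l) < eps)).
  by exists (mkposreal _ He).
Qed.

Lemma filterlim_locally_norm_iff {T : Type} (F : (T -> Prop) -> Prop) {FF : Filter F}
    (f : T -> V) (l : V) :
  filterlim f F (locally l) <->
  forall eps, 0 < eps -> F (fun u => norm (minus (f u) l) < eps).
Proof.
  split.
  - move=> H eps He. apply (H (fun z => norm (minus z l) < eps)).
    by apply locally_norm_small.
  - move=> H P /locally_norm_le_locally [e HP].
    rewrite /filtermap.
    apply: filter_imp (H e (cond_pos e)) => u Hu. by apply HP.
Qed.

End Norms.

(** * Orbits of a semigroup generated in the Laplace sense *)

Lemma is_RInt_linear {U V : NormedModule R_AbsRing} (L : U -> V) (HL : is_linear L)
    (f : R -> U) (a b : R) (I : U) :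
  is_RInt f a b I -> is_RInt (fun r => L (f r)) a b (L I).
Proof.
  move=> HI.
  apply: (filterlim_ext
    (fun ptd => L (scal (sign (b - a)) (Riemann_sum f ptd)))).
  { move=> ptd. rewrite (linear_scal L HL). f_equal.
    apply (SF_cons_ind (fun ptd =>
      L (Riemann_sum f ptd) = Riemann_sum (fun r => L (f r)) ptd)) => [x0 | h s IH].
    - by apply (linear_zero L HL).
    - by rewrite !Riemann_sum_cons (linear_plus L HL) (linear_scal L HL) IH. }
  apply: filterlim_comp HI _. by apply linear_cont.
Qed.

Lemma is_RInt_gen_linear {U V : NormedModule R_AbsRing} (L : U -> V)
    (HL : is_linear L) (Fa Fb : (R -> Prop) -> Prop) {FFa : Filter Fa} {FFb : Filter Fb}
    (f : R -> U) (I : U) :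
  is_RInt_gen f Fa Fb I -> is_RInt_gen (fun r => L (f r)) Fa Fb (L I).
Proof.
  move=> HI P HP.
  have HQ : locally I (fun u => P (L u)) by apply (linear_cont L I HL).
  rewrite /filtermapi. eapply filter_imp; last by apply (HI _ HQ).
  move=> ab [u [Hu Pu]].
  exists (L u). split=> //. by apply is_RInt_linear.
Qed.

(** Makes the convergence explicit in the two endpoints, so that it can be used at
    several pairs of endpoints at once. *)
Lemma is_RInt_gen_primitive {V : CompleteNormedModule R_AbsRing} (k K : R -> V) (I : V) :
  (forall a b, 0 < a -> 0 < b -> is_RInt k a b (minus (K b) (K a))) ->
  is_RInt_gen k (at_right 0) (Rbar_locally p_infty) I ->
  forall eps, 0 < eps -> exists a0 b0, 0 < a0 /\ 0 < b0 /\
    forall a b, 0 < a < a0 -> b0 < b -> norm (minus (minus (K b) (K a)) I) < eps.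
Proof.
  move=> HK HI eps He.
  have HP : locally I (fun u => norm (minus u I) < eps).
  { by apply locally_norm_small. }
  case: (HI _ HP) => P Q [d HP'] [M HQ] H.
  exists d, (Rmax M 1). split; first by apply cond_pos.
  split; first by have := Rmax_r M 1; lra.
  move=> a b Ha Hb.
  have HbM := Rmax_l M 1. have Hb1 := Rmax_r M 1.
  case: (H a b).
  - apply HP'; last lra. rewrite /ball /= /AbsRing_ball /abs /minus /plus /opp /=.
    rewrite Rabs_pos_eq; lra.
  - apply HQ. lra.
  - move=> u /= [Hu Pu].
    by rewrite -(is_RInt_unique _ _ _ _ (HK a b ltac:(lra) ltac:(lra)))
               (is_RInt_unique _ _ _ _ Hu).
Qed.

Section Orbits.
Variable X : CompleteNormedModule R_AbsRing.
Variables (DA : X -> Prop) (A : X -> X) (Sg : R -> X -> X).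
Hypothesis HS : semigroup Sg.
Hypothesis HG : generates DA A Sg.

(** The resolvent is an integral of semigroup operators, hence commutes with each of
    them; this passes to [A], since the resolvent determines [A]. *)
Lemma generator_commutes (t : R) (v : X) :
  0 <= t -> DA v -> DA (Sg t v) /\ A (Sg t v) = Sg t (A v).
Proof.
  move=> Ht Hv. case: HG => w Hw. set l := w + 1.
  set z := minus (scal l v) (A v).
  have Hl : w < l by rewrite /l; lra.
  have HL := semigroup_bounded HS Ht.
  case: (Hw l Hl z) => v1 [HI /(_ v) [H1 _]].
  have Ev : v = v1 by apply H1. subst v1.
  case: (Hw l Hl (Sg t z)) => v2 [HI2 /(_ v2) [_ H2]].
  have E : v2 = Sg t v.
  { pose proof (is_RInt_gen_linear _ HL (at_right 0) (Rbar_locally p_infty) _ _ HI) as HI1.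
    rewrite -(is_RInt_gen_unique _ _ HI2) -(is_RInt_gen_unique _ _ HI1).
    apply: RInt_gen_ext; last by exists v2.
    apply (Filter_prod _ _ _ (fun a => 0 < a) (fun b => 0 < b)).
    - by exists (mkposreal 1 Rlt_0_1).
    - by exists 0.
    - move=> a b Ha Hb r /= Hr.
      have Hr0 : 0 < r by have := Rmin_glb_lt a b 0 Ha Hb; lra.
      rewrite (linear_scal _ HL) -!(semigroup_plus HS) ; try lra.
      by rewrite Rplus_comm. }
  case: (H2 eq_refl) => D E2. rewrite E in D E2.
  split=> //.
  have E3 : minus (scal l (Sg t v)) (A (Sg t v)) =
            minus (scal l (Sg t v)) (Sg t (A v)).
  { rewrite E2 /z (linear_minus _ _ _ HL) (linear_scal _ HL). done. }
  have -> : A (Sg t v) = minus (scal l (Sg t v))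
              (minus (scal l (Sg t v)) (A (Sg t v))) by abelian.
  rewrite E3. abelian.
Qed.

(** For [v] in the domain, [v] is the Laplace integral of the orbit of
    [z = l v - A v].  Applying [S(t)] shifts this integral, so [exp (- l t) S(t) v] is
    its tail from [t] on, whose derivative is the integrand with opposite sign.  As the
    orbit may be singular at [0], the tail is handled through a primitive [K] based at
    time [1]. *)
Lemma orbit_derivative_domain (t : R) (v : X) :
  0 < t -> DA v -> is_derive (fun r => Sg r v) t (Sg t (A v)).
Proof.
  move=> Ht Hv. case: HG => w Hw. set l := w + 1.
  set z := minus (scal l v) (A v).
  have Hl : w < l by rewrite /l; lra.
  case: (Hw l Hl z) => v1 [HI /(_ v) [H1 _]].
  have Ev : v = v1 by apply H1. subst v1. move: {H1} HI.
  set k := fun r => scal (exp (- (l * r))) (Sg r z) => HI.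
  have Hexp : forall r, is_derive (fun r => exp (- (l * r))) r (- l * exp (- (l * r))).
  { move=> r. auto_derive=> //. ring. }
  have Hk : forall r, 0 < r -> continuous k r.
  { move=> r Hr. apply (continuous_scal (fun r => exp (- (l * r))) (fun r => Sg r z)).
    - apply: ex_derive_continuous. by eexists; apply Hexp.
    - by apply (semigroup_continuous HS). }
  have Hex : forall a b, 0 < a -> 0 < b -> ex_RInt k a b.
  { move=> a b Ha Hb. apply: ex_RInt_continuous => r Hr. apply Hk.
    have := Rmin_glb_lt a b 0 Ha Hb. lra. }
  set K := fun r => RInt k 1 r.
  have HK : forall a b, 0 < a -> 0 < b -> is_RInt k a b (minus (K b) (K a)).
  { move=> a b Ha Hb.
    have -> : minus (K b) (K a) = RInt k a b.
    { rewrite /K -(RInt_Chasles k 1 a b); [abelian | apply Hex | apply Hex]; lra. }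
    apply RInt_correct. by apply Hex. }
  have HKd : forall r, 0 < r -> is_derive K r (k r).
  { move=> r Hr. apply (is_derive_RInt k K 1); last by apply Hk.
    exists (mkposreal r Hr) => b Hb. apply RInt_correct. apply Hex; first lra.
    move: Hb. rewrite /ball /= /AbsRing_ball /abs /minus /plus /opp /= => Hb.
    have := Rabs_def2 _ _ Hb. lra. }
  have HKc : forall r, 0 < r -> continuous K r.
  { move=> r Hr. apply: ex_derive_continuous. by exists (k r); apply HKd. }
  set q := fun r => scal (exp (- (l * r))) (Sg r v).
  (* The semigroup shifts the integrand, up to the exponential factor. *)
  have Hshift : forall r a b, 0 < r -> 0 < a -> 0 < b ->
    scal (exp (- (l * r))) (Sg r (minus (K b) (K a))) =
    minus (K (b + r)) (K (a + r)).
  { move=> r a b Hr Ha Hb.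
    have HL := semigroup_bounded HS (Rlt_le _ _ Hr).
    have E1 := is_RInt_scal _ _ _ (exp (- (l * r))) _
                 (is_RInt_linear _ HL _ _ _ _ (HK a b Ha Hb)).
    have E2 : is_RInt (fun y => scal 1 (k (1 * y + r))) a b
                (minus (K (b + r)) (K (a + r))).
    { apply (is_RInt_comp_lin k 1 r a b). rewrite !Rmult_1_l. apply HK; lra. }
    rewrite -(is_RInt_unique _ _ _ _ E1) -(is_RInt_unique _ _ _ _ E2).
    apply RInt_ext => y Hy.
    have Hy0 : 0 < y by have := Rmin_glb_lt a b 0 Ha Hb; lra.
    rewrite /k (linear_scal _ HL) -(semigroup_plus HS); try lra.
    rewrite scal_one scal_assoc Rmult_1_l (Rplus_comm y r). f_equal.
    rewrite /mult /= -exp_plus. f_equal. ring. }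
  (* Hence [K] has a limit at [0], and [q + K] does not depend on time. *)
  have HK0 : forall r, 0 < r ->
    filterlim K (at_right 0) (locally (minus (plus (K r) (q r)) v)).
  { move=> r Hr. apply (proj2 (filterlim_locally_norm_iff X (at_right 0) _ _)) => eps He.
    have HL := semigroup_bounded HS (Rlt_le _ _ Hr).
    case: (linear_norm _ HL) => M [HM HMb].
    set c := exp (- (l * r)). have Hc : 0 < c by apply exp_pos.
    have Hd : 0 < eps / (3 * (1 + c * M)).
    { apply Rdiv_lt_0_compat => //. have := Rmult_lt_0_compat _ _ Hc HM. lra. }
    case: (is_RInt_gen_primitive k K v HK HI _ Hd) => a0 [b0 [Ha0 [Hb0 Hab]]].
    have He3 : 0 < eps / 3 by lra.
    have [d Hd2] := HKc r Hr _ (locally_norm_small _ (K r) _ He3).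
    have Hm : 0 < Rmin a0 d by apply Rmin_glb_lt => //; apply cond_pos.
    exists (mkposreal _ Hm) => a. rewrite /ball /= /AbsRing_ball /abs /minus /plus /opp /=.
    move=> Hba Ha.
    have [Hba1 _] := Rabs_def2 _ _ Hba. have Hm1 := Rmin_l a0 d. have Hm2 := Rmin_r a0 d.
    have I1 : norm (minus (K (a + r)) (K r)) < eps / 3.
    { apply Hd2. rewrite /ball /= /AbsRing_ball /abs /minus /plus /opp /=.
      rewrite Rabs_pos_eq; lra. }
    have I2 : norm (minus (minus (K (b0 + 1 + r)) (K a)) v) < eps / (3 * (1 + c * M)).
    { apply Hab; lra. }
    have I3 : norm (minus (minus (K (b0 + 1)) (K a)) v) < eps / (3 * (1 + c * M)).
    { apply Hab; lra. }
    have E : minus (K a) (minus (plus (K r) (q r)) v) =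
      plus (minus (K (a + r)) (K r))
        (plus (opp (minus (minus (K (b0 + 1 + r)) (K a)) v))
          (scal c (Sg r (minus (minus (K (b0 + 1)) (K a)) v)))).
    { rewrite (linear_minus _ _ _ HL) scal_minus_distr_l Hshift; try lra.
      rewrite -/(q r). abelian. }
    change (norm (minus (K a) (minus (plus (K r) (q r)) v)) < eps). rewrite E.
    have HcM := Rmult_lt_0_compat _ _ Hc HM.
    set d' := eps / (3 * (1 + c * M)) in Hd I2 I3 |- *.
    have E3 : d' + c * (M * d') = eps / 3 by rewrite /d'; field; lra.
    apply: (Rle_lt_trans _ (eps / 3 + (d' + c * (M * d')))); last lra.
    apply: norm_plus_bound; first exact: Rlt_le.
    apply: norm_plus_bound; first exact/norm_opp_bound/Rlt_le.
    apply: norm_scal_bound; first by rewrite Rabs_pos_eq; lra.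
    apply: Rle_trans (HMb _) _. apply Rmult_le_compat_l; first lra. exact: Rlt_le. }
  have Hconst : forall r, 0 < r -> q r = minus (plus (K t) (q t)) (K r).
  { move=> r Hr.
    have E : minus (plus (K r) (q r)) v = minus (plus (K t) (q t)) v.
    { exact (filterlim_locally_unique (F:=at_right 0) K _ _ (HK0 r Hr) (HK0 t Ht)). }
    have -> : q r = plus (minus (minus (plus (K r) (q r)) v) (K r)) v by abelian.
    rewrite E. abelian. }
  have Hq : is_derive q t (opp (k t)).
  { apply (is_derive_ext_loc (fun r => minus (plus (K t) (q t)) (K r))).
    - exists (mkposreal t Ht) => r Hr. symmetry. apply Hconst.
      move: Hr. rewrite /ball /= /AbsRing_ball /abs /minus /plus /opp /= => Hr.
      have := Rabs_def2 _ _ Hr. lra.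
    - have -> : opp (k t) = minus zero (k t) by abelian.
      exact (is_derive_minus (V := X) _ K t zero (k t)
               (is_derive_const (V := X) _ t) (HKd t Ht)). }
  have He : is_derive (fun r => exp (l * r)) t (l * exp (l * t)).
  { auto_derive=> //. ring. }
  apply (is_derive_ext (fun r => scal (exp (l * r)) (q r))).
  { move=> r. rewrite /q scal_assoc. have -> : mult (exp (l * r)) (exp (- (l * r))) = one.
    { rewrite /mult /one /= -exp_plus -exp_0. f_equal. ring. }
    by rewrite scal_one. }
  have HL := semigroup_bounded HS (Rlt_le _ _ Ht).
  have H := filterdiff_scal_fct t (fun r => exp (l * r)) q _ _ Rmult_comm He Hq.
  eapply filterdiff_ext_lin; first exact H.
  move=> r /=. rewrite /q /k /z !(linear_minus _ _ _ HL) (linear_scal _ HL).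
  rewrite !scal_opp_r.
  have Ee : exp (- (l * t)) = / exp (l * t) by apply exp_Ropp.
  have Hp := exp_pos (l * t).
  rewrite !scal_minus_distr_l.
  rewrite !scal_assoc Ee /mult /=.
  set e := exp (l * t) in Hp |- *.
  have C1 : scal (r * l) e * / e = r * l.
  { rewrite /scal /= /mult /=. field. lra. }
  have C2 : e * r * / e * l = r * l by field; lra.
  have C3 : e * r * / e = r by field; lra.
  rewrite C1 C2 C3. abelian.
Qed.

(** From time [t/2] on, such an orbit is the orbit of a vector of the domain. *)
Lemma orbit_derivative (v : X) :
  (forall t, 0 < t -> DA (Sg t v)) ->
  forall t, 0 < t ->
    is_derive (fun r => Sg r v) t (A (Sg t v)) /\
    continuous (fun r => A (Sg r v)) t.
Proof.
  move=> Hv t Ht.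
  have Hloc : locally t (fun r => t / 2 < r).
  { have Ht2 : 0 < t / 2 by lra.
    exists (mkposreal _ Ht2) => r.
    rewrite /ball /= /AbsRing_ball /abs /minus /plus /opp /= => Hr.
    have := Rabs_def2 _ _ Hr. lra. }
  have Hs : forall r, t / 2 < r -> Sg r v = Sg (r - t / 2) (Sg (t / 2) v).
  { move=> r Hr. rewrite -(semigroup_plus HS); try lra. f_equal. ring. }
  have HA : forall r, t / 2 < r -> A (Sg r v) = Sg (r - t / 2) (A (Sg (t / 2) v)).
  { move=> r Hr. rewrite Hs //.
    apply generator_commutes; first lra. apply Hv. lra. }
  have Hsh : is_derive (fun r => r - t / 2) t 1 by auto_derive.
  split.
  - apply (is_derive_ext_loc (fun r => Sg (r - t / 2) (Sg (t / 2) v))).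
    { apply: filter_imp Hloc => r Hr. by rewrite -Hs. }
    rewrite HA; last lra.
    rewrite -(scal_one (Sg (t - t / 2) (A (Sg (t / 2) v)))).
    apply (is_derive_comp (fun r => Sg r (Sg (t / 2) v)) (fun r => r - t / 2)) => //.
    apply orbit_derivative_domain; first lra. apply Hv. lra.
  - apply (continuous_ext_loc _ (fun r => Sg (r - t / 2) (A (Sg (t / 2) v)))).
    { apply: filter_imp Hloc => r Hr. by rewrite -HA. }
    apply (continuous_comp (fun r => r - t / 2) (fun r => Sg r (A (Sg (t / 2) v)))).
    + apply: ex_derive_continuous. by eexists; apply Hsh.
    + apply (semigroup_continuous HS). lra.
Qed.

End Orbits.

(** * Powers and geometric telescoping *)

Lemma Rpower_small (C g eps : R) :
  0 <= C -> 0 < g -> 0 < eps ->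
  exists d, 0 < d /\ forall r, 0 < r < d -> C * Rpower r g < eps.
Proof.
  move=> HC Hg He.
  have Hd : 0 < eps / (C + 1) by apply Rdiv_lt_0_compat; lra.
  exists (Rpower (eps / (C + 1)) (/ g)). split; first by apply exp_pos.
  move=> r Hr.
  have H1 : Rpower r g <= eps / (C + 1).
  { have := Rle_Rpower_l r (Rpower (eps / (C + 1)) (/ g)) g ltac:(lra) ltac:(lra).
    rewrite Rpower_mult Rinv_l; last lra. by rewrite Rpower_1. }
  have H2 := Rmult_le_compat_l C _ _ HC H1.
  have E : C * (eps / (C + 1)) = eps - eps / (C + 1) by field; lra.
  lra.
Qed.

Lemma Rpower_half_lt_1 (g : R) : 0 < g -> 0 < Rpower (/ 2) g < 1.
Proof.
  move=> Hg. split; first by apply exp_pos.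
  rewrite /Rpower -[X in _ < X]exp_0. apply exp_increasing.
  have H : ln (/ 2) < 0 by rewrite -ln_1; apply ln_increasing; lra.
  have := Rmult_lt_compat_l g _ _ Hg H. lra.
Qed.

Lemma Rpower_half_scale (L g : R) :
  0 < L -> Rpower (L / 2) g = Rpower L g * Rpower (/ 2) g.
Proof. move=> HL. rewrite Rpower_mult_distr //; lra. Qed.

Lemma Rpower_half_pow (L g : R) (n : nat) :
  0 < L -> Rpower (L * (/ 2) ^ n) g = Rpower L g * Rpower (/ 2) g ^ n.
Proof.
  move=> HL. elim: n => [|n IH] /=.
  - by rewrite !Rmult_1_r.
  - have Hn : 0 < (/ 2) ^ n by apply pow_lt; lra.
    have -> : L * (/ 2 * (/ 2) ^ n) = (L * (/ 2) ^ n) / 2 by field.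
    rewrite Rpower_half_scale; last by apply Rmult_lt_0_compat.
    rewrite IH. ring.
Qed.

Lemma Rpower_nonneg (r g : R) : 0 <= Rpower r g.
Proof. apply Rlt_le, exp_pos. Qed.

Lemma pow_half_small (L d : R) :
  0 < L -> 0 < d -> exists n0, forall n, (n0 <= n)%nat -> L * (/ 2) ^ n < d.
Proof.
  move=> HL Hd.
  case: (pow_lt_1_zero (/ 2) _ (d / L)); first by rewrite Rabs_pos_eq; lra.
  { by apply Rdiv_lt_0_compat. }
  move=> n0 Hn0. exists n0 => n Hn. have := Hn0 n Hn.
  rewrite Rabs_pos_eq; last by apply pow_le; lra.
  move=> H. have := Rmult_lt_compat_l L _ _ HL H.
  have -> : L * (d / L) = d by field; lra. done.
Qed.

Section Telescoping.
Variable X : CompleteNormedModule R_AbsRing.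
Variables (E : X -> Prop) (N : X -> R).
Hypothesis HE : banach_subspace E N.

Lemma subspace_minus (u v : X) : E u -> E v -> E (minus u v).
Proof.
  move=> Hu Hv. have L := banach_subspace_linear HE.
  have -> : minus u v = plus u (scal (opp one) v) by rewrite scal_opp_one.
  apply (subspace_plus L) => //. by apply (subspace_scal L).
Qed.

Lemma subspace_norm_zero : N zero = 0.
Proof.
  have L := banach_subspace_linear HE.
  have := banach_norm_scal HE 0 (subspace_zero L).
  by rewrite Rabs_R0 Rmult_0_l scal_zero_r.
Qed.

Lemma subspace_norm_opp (u : X) : E u -> N (opp u) = N u.
Proof.
  move=> Hu. rewrite -(scal_opp_one u). rewrite (banach_norm_scal HE) //.
  rewrite /opp /one /= Rabs_Ropp Rabs_R1. ring.
Qed.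

Lemma subspace_norm_minus (u v : X) : E u -> E v -> N (minus u v) <= N u + N v.
Proof.
  move=> Hu Hv. rewrite -(subspace_norm_opp v) //.
  apply (banach_norm_plus HE) => //.
  have := subspace_minus _ _ (subspace_zero (banach_subspace_linear HE)) Hv.
  by have -> : minus zero v = opp v by abelian.
Qed.

(** A sequence with geometrically small increments in the norm of [E] stays in [E]
    in the limit, even if the limit is only known in the weaker norm of [X]. *)
Lemma geometric_limit (c0 c r : R) (u : nat -> X) (l : X) :
  (forall z, E z -> norm z <= c0 * N z) ->
  0 <= c -> 0 < r < 1 -> (forall n, E (u n)) ->
  (forall n, N (minus (u (S n)) (u n)) <= c * r ^ n) ->
  (forall eps, 0 < eps -> exists n0, forall n, (n0 <= n)%nat ->
     norm (minus (u n) l) < eps) ->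
  E l /\ N (minus l (u 0%nat)) <= c / (1 - r).
Proof.
  move=> Hc0 Hc Hr Hu Hinc Hlim.
  have HL := banach_subspace_linear HE.
  have Hc1 : 0 <= c / (1 - r) by apply Rdiv_le_0_compat; lra.
  have Htel : forall n k, N (minus (u (n + k)%nat) (u n)) <= c / (1 - r) * r ^ n * (1 - r ^ k).
  { move=> n. elim=> [|k IH].
    - rewrite Nat.add_0_r. have -> : minus (u n) (u n) = zero by abelian.
      rewrite subspace_norm_zero /=. lra.
    - have -> : (n + S k = S (n + k))%nat by lia.
      have -> : minus (u (S (n + k))) (u n) =
        plus (minus (u (S (n + k))) (u (n + k)%nat)) (minus (u (n + k)%nat) (u n))
        by abelian.
      apply: Rle_trans (banach_norm_plus HE _ _) _; try by apply subspace_minus.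
      have H1 := Hinc (n + k)%nat. rewrite pow_add in H1.
      have E1 : c / (1 - r) * r ^ n * (1 - r ^ S k) =
        c * (r ^ n * r ^ k) + c / (1 - r) * r ^ n * (1 - r ^ k).
      { simpl. field. lra. }
      lra. }
  have Htel' : forall n k, N (minus (u (n + k)%nat) (u n)) <= c / (1 - r) * r ^ n.
  { move=> n k. apply: Rle_trans (Htel n k) _.
    have Hn : 0 <= r ^ n by apply pow_le; lra.
    have Hk : 0 <= r ^ k by apply pow_le; lra.
    have := Rmult_le_pos _ _ (Rmult_le_pos _ _ Hc1 Hn) Hk. lra. }
  have Hcauchy : forall eps, 0 < eps -> exists n0 : nat, forall n m : nat,
       (n0 <= n)%nat -> (n0 <= m)%nat -> N (minus (u n) (u m)) < eps.
  { move=> eps He.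
    have He2 : 0 < eps / (2 * (c / (1 - r) + 1)) by apply Rdiv_lt_0_compat; lra.
    case: (pow_lt_1_zero r _ _ He2); first by rewrite Rabs_pos_eq; lra.
    move=> n0 Hn0. exists n0 => n m Hn Hm.
    have Hb : forall k, (n0 <= k)%nat -> N (minus (u k) (u n0)) < eps / 2.
    { move=> k Hk. have := Htel' n0 (k - n0)%nat.
      have -> : (n0 + (k - n0) = k)%nat by lia. move=> H1.
      have := Hn0 n0 (le_n _). rewrite Rabs_pos_eq; last by apply pow_le; lra. move=> H2.
      have H3 := Rmult_le_compat_l _ _ _ Hc1 (Rlt_le _ _ H2).
      have E1 : c / (1 - r) * (eps / (2 * (c / (1 - r) + 1))) =
                eps / 2 - eps / (2 * (c / (1 - r) + 1)).
      { set b := c / (1 - r) in Hc1 |- *. field. lra. }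
      lra. }
    have -> : minus (u n) (u m) = minus (minus (u n) (u n0)) (minus (u m) (u n0))
      by abelian.
    apply: Rle_lt_trans (subspace_norm_minus _ _ _ _) _; try by apply subspace_minus.
    have := Hb n Hn. have := Hb m Hm. lra. }
  case: (banach_complete HE Hu Hcauchy) => z [Hz Hlz].
  have Hlz' : forall eps, 0 < eps -> exists n0, forall n, (n0 <= n)%nat ->
      N (minus (u n) z) < eps.
  { move=> eps He. apply is_lim_seq_spec in Hlz.
    case: (Hlz (mkposreal _ He)) => n0 /= Hn0. exists n0 => n Hn.
    have := Hn0 n Hn. rewrite Rminus_0_r => H. have := Rle_abs (N (minus (u n) z)). lra. }
  have El : l = z.
  { apply eq_of_norm_small => eps He.
    have He2 : 0 < eps / 2 by lra.
    have He3 : 0 < eps / (2 * (Rabs c0 + 1)).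
    { apply Rdiv_lt_0_compat => //. have := Rabs_pos c0. lra. }
    case: (Hlim _ He2) => n1 Hn1. case: (Hlz' _ He3) => n2 Hn2.
    have H1 := Hn1 (n1 + n2)%nat ltac:(lia). have H2 := Hn2 (n1 + n2)%nat ltac:(lia).
    have H3 := Hc0 _ (subspace_minus _ _ (Hu (n1 + n2)%nat) Hz).
    have -> : minus l z = minus (minus (u (n1 + n2)%nat) z) (minus (u (n1 + n2)%nat) l)
      by abelian.
    apply: (Rle_trans _ (eps / 2 + eps / 2)); last lra.
    apply: norm_minus_bound; last exact: Rlt_le.
    apply: Rle_trans H3 _.
    have Hc0' : 0 <= Rabs c0 by apply Rabs_pos.
    have HN : 0 <= N (minus (u (n1 + n2)%nat) z).
    { have := subspace_norm_minus _ _ (subspace_minus _ _ (Hu (n1 + n2)%nat) Hz)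
               (subspace_minus _ _ (Hu (n1 + n2)%nat) Hz).
      have -> : minus (minus (u (n1 + n2)%nat) z) (minus (u (n1 + n2)%nat) z) = zero
        by abelian.
      rewrite subspace_norm_zero. lra. }
    have H4 := Rmult_le_compat_r _ _ _ HN (Rle_abs c0).
    have H5 := Rmult_le_compat_l _ _ _ Hc0' (Rlt_le _ _ H2).
    have E1 : Rabs c0 * (eps / (2 * (Rabs c0 + 1))) = eps / 2 - eps / (2 * (Rabs c0 + 1)).
    { field. lra. }
    lra. }
  subst z. split=> //.
  apply le_epsilon => eps He. case: (Hlz' _ He) => n Hn.
  have H1 := Hn n (le_n _). have H2 := Htel' 0%nat n. rewrite Nat.add_0_l /= Rmult_1_r in H2.
  have -> : minus l (u 0%nat) = minus (minus (u n) (u 0%nat)) (minus (u n) l) by abelian.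
  apply: Rle_trans (subspace_norm_minus _ _ _ _) _; try by apply subspace_minus.
  lra.
Qed.

End Telescoping.

(** * Dyadic sums of the convolution *)

Section Sewing.
Variable X : CompleteNormedModule R_AbsRing.
Variables (Sg : R -> X -> X) (f : R -> X) (x : R -> R).
Hypothesis HS : semigroup Sg.

(** The Riemann sums of [r => Sg (t - r) (f r)] against [dx] over partitions of
    [s,t] with mesh below [d], generated from left to right: prolonging the interval
    from [u] to [t] applies [Sg (t - u)] to the sum already collected. *)
Inductive convolution_sum (d s : R) : R -> X -> Prop :=
| convolution_sum_nil : convolution_sum d s s zero
| convolution_sum_snoc u t v :
    convolution_sum d s u v -> u < t -> t - u < d ->
    convolution_sum d s t
      (plus (Sg (t - u) v) (scal (x t - x u) (Sg (t - u) (f u)))).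

Lemma convolution_sum_young (d s t : R) (v : X) :
  convolution_sum d s t v ->
  s <= t /\
  exists n p, is_partition s t n p /\ mesh_lt d n p /\
    forall t', t <= t' -> young_sum x (fun r => Sg (t' - r) (f r)) n p = Sg (t' - t) v.
Proof.
  elim=> [|u t0 w _ [Hsu [n [p [[Hp0 [Hpn Hpi]] [Hm HY]]]]] Hut Hd].
  - split; first lra. exists 0%nat, (fun _ => s). split; first by split=> //; split=> //; lia.
    split; first by move=> i Hi; lia.
    move=> t' Ht'. rewrite /young_sum sum_n_m_zero; last lia.
    symmetry. apply (linear_zero (Sg (t' - s))). apply (semigroup_bounded HS). lra.
  - split; first lra.
    set p' := fun i => if Nat.leb i n then p i else t0.
    have Hp' : forall i, (i <= n)%nat -> p' i = p i.
    { move=> i Hi. rewrite /p'. by have -> : Nat.leb i n = true by apply Nat.leb_le. }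
    have Hp'n : p' (S n) = t0.
    { rewrite /p'. by have -> : Nat.leb (S n) n = false by apply Nat.leb_gt; lia. }
    exists (S n), p'. split; [split; [|split] | split].
    + rewrite Hp' //. lia.
    + done.
    + move=> i Hi. case: (Nat.eq_dec i n) => [->|Hne].
      * by rewrite Hp'n Hp' // Hpn.
      * rewrite !Hp'; try lia. apply Hpi. lia.
    + move=> i Hi. case: (Nat.eq_dec i n) => [->|Hne].
      * by rewrite Hp'n Hp' // Hpn.
      * rewrite !Hp'; try lia. apply Hm. lia.
    + move=> t' Ht'. rewrite /young_sum sum_n_Sm; last lia.
      rewrite (sum_n_m_ext_loc _
        (fun i => scal (x (p i) - x (p (pred i))) (Sg (t' - p (pred i)) (f (p (pred i)))))).
      2: { move=> i Hi. rewrite !Hp' //; lia. }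
      have H := HY t' ltac:(lra). rewrite /young_sum in H. rewrite H /= Hp'n Hp' // Hpn.
      have HL : is_linear (Sg (t' - t0)) by apply (semigroup_bounded HS); lra.
      rewrite (linear_plus _ HL) (linear_scal _ HL) -!(semigroup_plus HS); try lra.
      have -> : t' - t0 + (t0 - u) = t' - u by ring. done.
Qed.

Lemma convolution_sum_cat (d s u t : R) (v w : X) :
  convolution_sum d s u v -> convolution_sum d u t w ->
  convolution_sum d s t (plus (Sg (t - u) v) w).
Proof.
  move=> Hv. elim=> [|t1 t2 w' H1 IH H12 Hd].
  - have -> : plus (Sg (u - u) v) zero = v; last done.
    by rewrite plus_zero_r Rminus_diag (semigroup_0 HS).
  - have [Hu1 _] := convolution_sum_young _ _ _ _ H1.
    have := convolution_sum_snoc _ _ _ t2 _ IH H12 Hd.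
    have HL : is_linear (Sg (t2 - t1)) by apply (semigroup_bounded HS); lra.
    rewrite (linear_plus _ HL) -!(semigroup_plus HS); try lra.
    have -> : t2 - t1 + (t1 - u) = t2 - u by ring. by rewrite plus_assoc.
Qed.

Fixpoint dyadic_sum (n : nat) (s t : R) : X :=
  match n with
  | O => scal (x t - x s) (Sg (t - s) (f s))
  | S n => plus (Sg (t - (s + t) / 2) (dyadic_sum n s ((s + t) / 2)))
                (dyadic_sum n ((s + t) / 2) t)
  end.

Lemma dyadic_sum_convolution (d : R) (n : nat) (s t : R) :
  s < t -> (t - s) * (/ 2) ^ n < d -> convolution_sum d s t (dyadic_sum n s t).
Proof.
  elim: n s t => [|n IH] s t Hst Hd /=.
  - have H := convolution_sum_snoc d s s t zero (convolution_sum_nil d s) Hst.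
    have -> : scal (x t - x s) (Sg (t - s) (f s)) =
      plus (Sg (t - s) zero) (scal (x t - x s) (Sg (t - s) (f s))).
    { rewrite (linear_zero (Sg (t - s))); last by apply (semigroup_bounded HS); lra.
      by rewrite plus_zero_l. }
    apply H. simpl in Hd. lra.
  - simpl in Hd. apply convolution_sum_cat; apply IH; lra.
Qed.

Lemma convolution_sum_exists (d s t : R) :
  0 < d -> s <= t -> exists v, convolution_sum d s t v.
Proof.
  move=> Hd [Hst|<-]; last by exists zero; constructor.
  case: (pow_half_small (t - s) d ltac:(lra) Hd) => n Hn.
  exists (dyadic_sum n s t). apply dyadic_sum_convolution => //. by apply Hn.
Qed.

(** Gluing a fine partition of [0,s] to the dyadic one of [s,t] turns the
    convergence of the Young sums over [0,s] and [0,t] into convergence of the dyadic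
    sums over [s,t]. *)
Lemma dyadic_sum_limit (s t : R) (Is It : X) :
  0 <= s < t ->
  is_young_int x (fun r => Sg (s - r) (f r)) 0 s Is ->
  is_young_int x (fun r => Sg (t - r) (f r)) 0 t It ->
  forall eps, 0 < eps -> exists n0, forall n, (n0 <= n)%nat ->
    norm (minus (dyadic_sum n s t) (minus It (Sg (t - s) Is))) < eps.
Proof.
  move=> Hst HIs HIt eps He.
  have HL : is_linear (Sg (t - s)) by apply (semigroup_bounded HS); lra.
  case: (linear_norm _ HL) => M [HM HMb].
  have He1 : 0 < eps / 2 by lra.
  have He2 : 0 < eps / (2 * M) by apply Rdiv_lt_0_compat; lra.
  case: (HIs _ He2) => ds [Hds Hs]. case: (HIt _ He1) => dt [Hdt Ht].
  have Hd : 0 < Rmin ds dt by apply Rmin_glb_lt.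
  have Hd1 := Rmin_l ds dt. have Hd2 := Rmin_r ds dt.
  case: (convolution_sum_exists _ 0 s Hd ltac:(lra)) => v Hv.
  case: (pow_half_small (t - s) _ ltac:(lra) Hd) => n0 Hn0.
  exists n0 => n Hn.
  have Hw := convolution_sum_cat _ _ _ _ _ _ Hv
               (dyadic_sum_convolution _ n s t ltac:(lra) (Hn0 n Hn)).
  have [_ [n1 [p1 [Hp1 [Hm1 HY1]]]]] := convolution_sum_young _ _ _ _ Hv.
  have [_ [n2 [p2 [Hp2 [Hm2 HY2]]]]] := convolution_sum_young _ _ _ _ Hw.
  have B1 : norm (minus v Is) < eps / (2 * M).
  { have H := HY1 s ltac:(lra). rewrite Rminus_diag (semigroup_0 HS) in H.
    rewrite -H. apply Hs => // i Hi. have := Hm1 i Hi. lra. }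
  have B2 : norm (minus (plus (Sg (t - s) v) (dyadic_sum n s t)) It) < eps / 2.
  { have H := HY2 t ltac:(lra). rewrite Rminus_diag (semigroup_0 HS) in H.
    rewrite -H. apply Ht => // i Hi. have := Hm2 i Hi. lra. }
  have -> : minus (dyadic_sum n s t) (minus It (Sg (t - s) Is)) =
    minus (minus (plus (Sg (t - s) v) (dyadic_sum n s t)) It) (Sg (t - s) (minus v Is)).
  { rewrite (linear_minus _ _ _ HL). abelian. }
  have B3 : norm (Sg (t - s) (minus v Is)) < eps / 2.
  { apply: Rle_lt_trans (HMb _) _.
    have := Rmult_lt_compat_l _ _ _ HM B1.
    have -> : M * (eps / (2 * M)) = eps / 2 by field; lra. done. }
  apply: (Rle_lt_trans _ _ _ (norm_minus_bound _ _ _ _ _ (Rle_refl _) (Rle_refl _))).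
  lra.
Qed.

Variables (T M0 Mf Mx alpha eta : R).
Hypothesis HM0 : 0 <= M0.
Hypothesis HMf : 0 <= Mf.
Hypothesis HMx : 0 <= Mx.
Hypothesis Halpha : 0 <= alpha.
Hypothesis Heta : 0 <= eta.
Hypothesis Hsum : 1 < alpha + eta.
Hypothesis HSb : forall t z, 0 <= t <= T -> norm (Sg t z) <= M0 * norm z.
Hypothesis Hf : forall s t, 0 <= s < t -> t <= T ->
  norm (minus (f t) (Sg (t - s) (f s))) <= Mf * Rpower (t - s) alpha.
Hypothesis Hx : forall s t, 0 <= s < t -> t <= T ->
  Rabs (x t - x s) <= Mx * Rpower (t - s) eta.

(** Refining one interval of length [L] changes the sum by [O(L^(alpha+eta))]; each
    of the [2^n] intervals of the next levels contributes [2^(-n(alpha+eta))] of it.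
    The operator [Sg tau] in front absorbs the products of semigroup operators, so
    that the constant [M0] occurs once and not once per level. *)
Lemma dyadic_sum_step (n : nat) (s t tau : R) :
  0 <= s < t -> t <= T -> 0 <= tau -> tau + (t - s) <= T ->
  norm (Sg tau (minus (dyadic_sum (S n) s t) (dyadic_sum n s t))) <=
    M0 * Mf * Mx * Rpower (t - s) (alpha + eta) * Rpower (/ 2) (alpha + eta - 1) ^ n.
Proof.
  elim: n s t tau => [|n IH] s t tau Hst HtT Htau Htl.
  - set u := (s + t) / 2.
    have HL := semigroup_bounded HS Htau.
    have -> : Sg tau (minus (dyadic_sum 1 s t) (dyadic_sum 0 s t)) =
      scal (x t - x u) (Sg (tau + (t - u)) (minus (f u) (Sg (u - s) (f s)))).
    { have HL1 : is_linear (Sg (t - u)).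
      { apply (semigroup_bounded HS). rewrite /u. lra. }
      rewrite (semigroup_plus HS) //; last by rewrite /u; lra.
      rewrite -(linear_scal _ HL). f_equal.
      rewrite (linear_minus _ _ _ HL1) /=. rewrite -/u (linear_scal _ HL1).
      rewrite -!(semigroup_plus HS); try by rewrite /u; lra.
      have -> : t - u + (u - s) = t - s by ring.
      have -> : x u - x s = minus (x t - x s) (x t - x u).
      { rewrite /minus /plus /opp /=. ring. }
      rewrite scal_minus_distr_r scal_minus_distr_l. abelian. }
    have H1 : Rabs (x t - x u) <= Mx * Rpower (t - s) eta.
    { apply: Rle_trans (Hx u t ltac:(rewrite /u; lra) HtT) _.
      apply Rmult_le_compat_l => //. apply Rle_Rpower_l => //. rewrite /u. lra. }
    have H2 : norm (minus (f u) (Sg (u - s) (f s))) <= Mf * Rpower (t - s) alpha.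
    { apply: Rle_trans (Hf s u ltac:(rewrite /u; lra) ltac:(rewrite /u; lra)) _.
      apply Rmult_le_compat_l => //. apply Rle_Rpower_l => //. rewrite /u. lra. }
    have H3 : norm (Sg (tau + (t - u)) (minus (f u) (Sg (u - s) (f s)))) <=
              M0 * (Mf * Rpower (t - s) alpha).
    { apply: Rle_trans (HSb _ _ _) _; first by rewrite /u; lra.
      by apply Rmult_le_compat_l. }
    apply: Rle_trans (norm_scal_bound _ _ _ _ _ H1 H3) _.
    rewrite Rpower_plus /=. apply Req_le. ring.
  - set u := (s + t) / 2.
    have HL := semigroup_bounded HS Htau.
    have Hu : t - u = (t - s) / 2 by rewrite /u; field.
    have Hu' : u - s = (t - s) / 2 by rewrite /u; field.
    have HL1 : is_linear (Sg (t - u)) by apply (semigroup_bounded HS); lra.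
    have -> : Sg tau (minus (dyadic_sum (S (S n)) s t) (dyadic_sum (S n) s t)) =
      plus (Sg (tau + (t - u)) (minus (dyadic_sum (S n) s u) (dyadic_sum n s u)))
           (Sg tau (minus (dyadic_sum (S n) u t) (dyadic_sum n u t))).
    { rewrite (semigroup_plus HS) //; last lra.
      rewrite -(linear_plus _ HL). f_equal.
      rewrite (linear_minus _ _ _ HL1).
      change (dyadic_sum (S (S n)) s t) with
        (plus (Sg (t - u) (dyadic_sum (S n) s u)) (dyadic_sum (S n) u t)).
      change (dyadic_sum (S n) s t) with
        (plus (Sg (t - u) (dyadic_sum n s u)) (dyadic_sum n u t)).
      abelian. }
    have H1 := IH s u (tau + (t - u)) ltac:(lra) ltac:(lra) ltac:(lra) ltac:(lra).
    have H2 := IH u t tau ltac:(lra) ltac:(lra) ltac:(lra) ltac:(lra).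
    apply: Rle_trans (norm_plus_bound _ _ _ _ _ H1 H2) _.
    rewrite Hu Hu' Rpower_half_scale; last lra.
    have -> : Rpower (/ 2) (alpha + eta) = / 2 * Rpower (/ 2) (alpha + eta - 1).
    { have -> : alpha + eta = 1 + (alpha + eta - 1) by ring.
      rewrite Rpower_plus Rpower_1; last lra. f_equal. f_equal. ring. }
    rewrite /=. apply Req_le. field.
Qed.

End Sewing.

(** * Primitives of functions with an integrable power singularity *)

Lemma is_derive_Rpower (a u : R) :
  0 < u -> is_derive (fun r => Rpower r a) u (a * Rpower u (a - 1)).
Proof.
  move=> Hu. have E : Rpower u (a - 1) = Rpower u a * / u.
  { by rewrite /Rminus Rpower_plus Rpower_Ropp Rpower_1. }
  rewrite E /Rpower. auto_derive=> //. field. lra.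
Qed.

Lemma is_RInt_Rpower (C a s t : R) :
  0 < a -> 0 < s <= t ->
  is_RInt (fun u => C * Rpower u (a - 1)) s t (C / a * (Rpower t a - Rpower s a)).
Proof.
  move=> Ha Hst.
  have -> : C / a * (Rpower t a - Rpower s a) =
    minus (C / a * Rpower t a) (C / a * Rpower s a).
  { rewrite /minus /plus /opp /=. ring. }
  apply (is_RInt_derive (fun u => C / a * Rpower u a)) => u;
    rewrite Rmin_left ?Rmax_right; try lra; move=> Hu.
  - have -> : C * Rpower u (a - 1) = C / a * (a * Rpower u (a - 1)) by field; lra.
    apply (is_derive_scal (fun r => Rpower r a)). apply is_derive_Rpower. lra.
  - apply: ex_derive_continuous. eexists.
    apply (is_derive_scal (fun r => Rpower r (a - 1))). apply is_derive_Rpower. lra.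
Qed.

Section SingularPrimitive.
Variable V : CompleteNormedModule R_AbsRing.

(** Right continuity, at [0] in particular, makes [G(t) - G(s)] the limit of the proper
    integrals over [s+e,t], whether or not [s] is the singular point. *)
Record singular_primitive (T : R) (g G : R -> V) : Prop := {
  primitive_0 : G 0 = zero;
  primitive_RInt : forall s t, 0 < s <= t -> t <= T ->
    is_RInt g s t (minus (G t) (G s));
  primitive_right : forall s, 0 <= s < T -> filterlim G (at_right s) (locally (G s)) }.

(** The bound [C u^(a-1)] has the primitive [C / a u^a], which is small near [0]; so the
    integrals over [s,T] have a limit as [s] tends to [0], and [G] inherits the
    modulus of continuity of [C / a u^a]. *)
Lemma singular_primitive_exists (T C a : R) (g : R -> V) :
  0 < T -> 0 < a -> 0 <= C -> (forall u, 0 < u -> continuous g u) ->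
  (forall u, 0 < u <= T -> norm (g u) <= C * Rpower u (a - 1)) ->
  exists G, singular_primitive T g G.
Proof.
  move=> HT Ha HC Hg Hb.
  have HCa : 0 <= C / a by apply Rdiv_le_0_compat.
  have Hex : forall s t, 0 < s -> 0 < t -> ex_RInt g s t.
  { move=> s t Hs Ht. apply: ex_RInt_continuous => r Hr. apply Hg.
    have := Rmin_glb_lt s t 0 Hs Ht. lra. }
  have Hbd : forall s t, 0 < s <= t -> t <= T ->
      norm (minus (RInt g s T) (RInt g t T)) <= C / a * (Rpower t a - Rpower s a).
  { move=> s t Hst HtT.
    have -> : minus (RInt g s T) (RInt g t T) = RInt g s t.
    { rewrite -(RInt_Chasles g s t T); [abelian | apply Hex | apply Hex]; lra. }
    apply: (norm_RInt_le g (fun u => C * Rpower u (a - 1)) s t); first lra.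
    - move=> u Hu. apply Hb. lra.
    - apply RInt_correct. apply Hex; lra.
    - by apply is_RInt_Rpower. }
  case: (proj1 (filterlim_locally_cauchy (F := at_right 0) (fun s => RInt g s T))).
  { move=> eps. case: (Rpower_small (C / a) a eps HCa Ha (cond_pos eps)) => d [Hd Hdb].
    exists (fun s => 0 < s < Rmin d T). split.
    - have Hm : 0 < Rmin d T by apply Rmin_glb_lt.
      exists (mkposreal _ Hm) => s.
      rewrite /ball /= /AbsRing_ball /abs /minus /plus /opp /= => Hs Hs0.
      have := Rabs_def2 _ _ Hs. lra.
    - have Hc : forall s t, 0 < s <= t -> t < Rmin d T ->
          norm (minus (RInt g s T) (RInt g t T)) < eps.
      { move=> s t Hst Ht. have H1 := Rmin_l d T. have H2 := Rmin_r d T.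
        apply: Rle_lt_trans (Hbd s t Hst _) _; first lra.
        have := Hdb t ltac:(lra).
        have := Rmult_le_pos _ _ HCa (Rpower_nonneg s a). lra. }
      move=> s t Hs Ht. apply: norm_compat1.
      case: (Rle_lt_dec s t) => Hst.
      + rewrite norm_minus_sym. apply Hc; lra.
      + apply Hc; lra. }
  move=> J0 HJ0.
  have HJ : forall t, 0 < t <= T -> norm (minus J0 (RInt g t T)) <= C / a * Rpower t a.
  { move=> t Ht. apply le_epsilon => eps He.
    have HF := proj1 (filterlim_locally_norm_iff V (at_right 0) _ _) HJ0 eps He.
    case: HF => d Hd.
    have Hm : 0 < Rmin d t by apply Rmin_glb_lt; [apply cond_pos | lra].
    have Hm1 := Rmin_l d t. have Hm2 := Rmin_r d t.
    set s := Rmin d t / 2.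
    have H1 : norm (minus (RInt g s T) J0) < eps.
    { apply Hd; last by rewrite /s; lra.
      rewrite /ball /= /AbsRing_ball /abs /minus /plus /opp /= Rabs_pos_eq /s; lra. }
    have H2 := Hbd s t ltac:(rewrite /s; lra) ltac:(lra).
    have := Rmult_le_pos _ _ HCa (Rpower_nonneg s a) => H3.
    have -> : minus J0 (RInt g t T) =
      minus (minus (RInt g s T) (RInt g t T)) (minus (RInt g s T) J0) by abelian.
    apply: Rle_trans (norm_minus_bound _ _ _ _ _ H2 (Rlt_le _ _ H1)) _. lra. }
  set G := fun u => match Rle_dec u 0 with
    left _ => zero | right _ => minus J0 (RInt g u T) end.
  have HG0 : G 0 = zero by rewrite /G; case: Rle_dec => //; lra.
  have HG : forall u, 0 < u -> G u = minus J0 (RInt g u T).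
  { move=> u Hu. rewrite /G. case: Rle_dec => //; lra. }
  exists G. split=> //.
  - move=> s t Hst Ht. rewrite !HG; try lra.
    have -> : minus (minus J0 (RInt g t T)) (minus J0 (RInt g s T)) = RInt g s t.
    { rewrite -(RInt_Chasles g s t T); [abelian | apply Hex | apply Hex]; lra. }
    apply RInt_correct. apply Hex; lra.
  - move=> s Hs. apply (proj2 (filterlim_locally_norm_iff V (at_right s) _ _)) => eps He.
    case: (Req_dec s 0) => [Es|Hs0].
    + subst s. case: (Rpower_small (C / a) a eps HCa Ha He) => d [Hd Hdb].
      have Hm : 0 < Rmin d T by apply Rmin_glb_lt.
      have H1 := Rmin_l d T. have H2 := Rmin_r d T.
      exists (mkposreal _ Hm) => u.
      rewrite /ball /= /AbsRing_ball /abs /minus /plus /opp /= => Hu Hu0.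
      have [Hu1 _] := Rabs_def2 _ _ Hu.
      change (norm (minus (G u) (G 0)) < eps).
      rewrite HG0 HG //.
      have -> : minus (minus J0 (RInt g u T)) zero = minus J0 (RInt g u T) by abelian.
      apply: Rle_lt_trans (HJ u _) _; first lra. apply Hdb. lra.
    + have Hc : continuous (fun u => C / a * Rpower u a) s.
      { apply: ex_derive_continuous. eexists.
        apply (is_derive_scal (fun r => Rpower r a)). apply is_derive_Rpower. lra. }
      case: (Hc _ (locally_ball (C / a * Rpower s a) (mkposreal _ He))) => d Hd.
      have Hm : 0 < Rmin d (T - s).
      { apply Rmin_glb_lt; [apply cond_pos | lra]. }
      have H1 := Rmin_l d (T - s). have H2 := Rmin_r d (T - s).
      exists (mkposreal _ Hm) => u Hu Hsu.
      have Hu1 : u < s + Rmin d (T - s).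
      { move: Hu. rewrite /ball /= /AbsRing_ball /abs /minus /plus /opp /= => Hu.
        have := Rabs_def2 _ _ Hu. lra. }
      have Hu2 : Rabs (C / a * Rpower u a - C / a * Rpower s a) < eps.
      { apply (Hd u). rewrite /ball /= /AbsRing_ball /abs /minus /plus /opp /=.
        rewrite Rabs_pos_eq; lra. }
      have [Hu3 _] := Rabs_def2 _ _ Hu2.
      rewrite !HG; try lra.
      have -> : minus (minus J0 (RInt g u T)) (minus J0 (RInt g s T)) =
        minus (RInt g s T) (RInt g u T) by abelian.
      apply: Rle_lt_trans (Hbd s u _ _) _; lra.
Qed.

Lemma singular_primitive_RInt_gen (T t : R) (g G : R -> V) :
  singular_primitive T g G -> 0 < t <= T ->
  is_RInt_gen g (at_right 0) (at_point t) (G t).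
Proof.
  move=> HG Ht P HP.
  have HQ : filterlim (fun u => minus (G t) (G u)) (at_right 0) (locally (G t)).
  { apply (proj2 (filterlim_locally_norm_iff V (at_right 0) _ _)) => eps He.
    have H := proj1 (filterlim_locally_norm_iff V (at_right 0) _ _)
                (primitive_right _ _ _ HG 0 ltac:(lra)) eps He.
    apply: filter_imp H => u. rewrite (primitive_0 _ _ _ HG) => Hu.
    rewrite norm_minus_sym.
    by have -> : minus (G t) (minus (G t) (G u)) = minus (G u) zero by abelian. }
  apply (Filter_prod _ _ _ (fun u => 0 < u < t /\ P (minus (G t) (G u))) (fun v => v = t)).
  - apply filter_and; last by apply HQ.
    have Ht0 : 0 < t by lra.
    exists (mkposreal _ Ht0) => u.
    rewrite /ball /= /AbsRing_ball /abs /minus /plus /opp /= => Hu Hu0.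
    have := Rabs_def2 _ _ Hu. lra.
  - done.
  - move=> u v [Hu HPu] ->. exists (minus (G t) (G u)). split=> //.
    apply (primitive_RInt _ _ _ HG); lra.
Qed.

End SingularPrimitive.

(** * The linear equation with a rough forcing *)

Section ForcedEquation.
Variable X : CompleteNormedModule R_AbsRing.
Variables (DA : X -> Prop) (A : X -> X) (Sg : R -> X -> X).
Variables (Xs : R -> X -> Prop) (nrm : R -> X -> R).
Variables (T : R) (x : R -> R) (eta alpha : R) (f y : R -> X) (K Mf Mx : R).
Hypothesis HT : 0 < T.
Hypothesis HSA : structural_assumptions DA A Sg Xs nrm.
Hypothesis Heta : 0 < eta.
Hypothesis Halpha : 0 < alpha < 1.
Hypothesis Hsum : 1 < alpha + eta.
Hypothesis HMx : 0 <= Mx.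
Hypothesis Hx : forall s t, 0 <= s < t -> t <= T ->
  Rabs (x t - x s) <= Mx * Rpower (t - s) eta.
Hypothesis HK : 0 <= K.
Hypothesis HfK : forall t, 0 <= t <= T -> Xs alpha (f t) /\ nrm alpha (f t) <= K.
Hypothesis HMf : 0 <= Mf.
Hypothesis Hf : forall s t, 0 <= s < t -> t <= T ->
  norm (minus (f t) (Sg (t - s) (f s))) <= Mf * Rpower (t - s) alpha.
Hypothesis Hy0 : Xs alpha (y 0).
Hypothesis Hmild : forall t, 0 <= t <= T -> exists I,
  is_young_int x (fun r => Sg (t - r) (f r)) 0 t I /\ y t = plus (Sg t (y 0)) I.

Let HS : semigroup Sg := sa_semigroup HSA.

(** The convolution over [s,t]: for a mild solution, the part of [y(t)] that is due to
    the forcing after time [s]. *)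
Definition flow_defect (s t : R) : X := minus (y t) (Sg (t - s) (y s)).

Lemma in_X0 (z : X) : Xs 0 z.
Proof. by case: (sa_X0 HSA z). Qed.

Lemma nrm_X0 (z : X) : nrm 0 z = norm z.
Proof. by case: (sa_X0 HSA z). Qed.

Lemma scale_norm_nonneg (a : R) (z : X) : 0 <= a < 2 -> Xs a z -> 0 <= nrm a z.
Proof.
  move=> Ha Hz. case: (sa_embedding HSA (a := a) (b := 0)); try lra.
  move=> c [Hc /(_ z Hz) [_ H]]. rewrite nrm_X0 in H.
  have Hn : 0 <= norm z by apply: norm_ge_0.
  apply (Rmult_le_reg_l c) => //. lra.
Qed.

Lemma semigroup_bound :
  exists M, 0 <= M /\ forall t z, 0 <= t <= T -> norm (Sg t z) <= M * norm z.
Proof.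
  case: (sa_smoothing HSA HT (zeta := 0) (a := 0)); try lra.
  move=> M [HM H]. exists (Rmax M 1).
  have H1 := Rmax_l M 1. have H2 := Rmax_r M 1. split; first lra.
  move=> t z Ht. have Hz : 0 <= norm z by apply: norm_ge_0.
  case: (Req_dec t 0) => [->|Ht0].
  - rewrite (semigroup_0 HS). have := Rmult_le_compat_r _ _ _ Hz H2. lra.
  - have [_ H3] := H t ltac:(lra) z (in_X0 z). rewrite !nrm_X0 in H3.
    rewrite Ropp_0 Rplus_0_r Rpower_O in H3; last lra.
    have := Rmult_le_compat_r _ _ _ Hz H1. lra.
Qed.

Lemma smoothing_domain (t : R) (v : X) : 0 < t -> DA (Sg t v).
Proof.
  move=> Ht. case: (sa_smoothing HSA Ht (zeta := 0) (a := 1)); try lra.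
  move=> M [_ H]. apply (sa_X1 HSA). apply (H t); [lra | apply in_X0].
Qed.

Lemma flow_defect_limit (s t : R) :
  0 <= s < t -> t <= T -> forall eps, 0 < eps -> exists n0, forall n, (n0 <= n)%nat ->
    norm (minus (dyadic_sum X Sg f x n s t) (flow_defect s t)) < eps.
Proof.
  move=> Hst HtT eps He.
  case: (Hmild s ltac:(lra)) => Is [HIs Es].
  case: (Hmild t ltac:(lra)) => It [HIt Et].
  have -> : flow_defect s t = minus It (Sg (t - s) Is).
  { have HL : is_linear (Sg (t - s)) by apply (semigroup_bounded HS); lra.
    rewrite /flow_defect Et Es (linear_plus _ HL) -(semigroup_plus HS); try lra.
    have -> : t - s + s = t by ring. abelian. }
  by apply (dyadic_sum_limit X Sg f x HS s t Is It).
Qed.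

(** The sewing estimate: the coarsest dyadic sum is the leading term, and the
    refinements add up to a geometric series. *)
Lemma flow_defect_sewing :
  exists C, 0 <= C /\ forall s t, 0 <= s < t -> t <= T ->
    norm (minus (flow_defect s t) (scal (x t - x s) (Sg (t - s) (f s)))) <=
      C * Rpower (t - s) (alpha + eta).
Proof.
  case: semigroup_bound => M0 [HM0 HSb].
  set r := Rpower (/ 2) (alpha + eta - 1).
  have Hr : 0 < r < 1 by apply Rpower_half_lt_1; lra.
  have HC : 0 <= M0 * Mf * Mx by apply Rmult_le_pos => //; apply Rmult_le_pos.
  exists (M0 * Mf * Mx / (1 - r)). split; first by apply Rdiv_le_0_compat; lra.
  move=> s t Hst HtT.
  have [_ H] := geometric_limit X (Xs 0) (nrm 0) (sa_banach HSA (a := 0) ltac:(lra)) 1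
     (M0 * Mf * Mx * Rpower (t - s) (alpha + eta)) r
     (fun n => dyadic_sum X Sg f x n s t) (flow_defect s t)
     ltac:(move=> z _; rewrite nrm_X0; lra)
     (Rmult_le_pos _ _ HC (Rpower_nonneg _ _)) Hr (fun n => in_X0 _)
     ltac:(move=> n; rewrite nrm_X0 -(semigroup_0 HS (minus _ _));
           apply (dyadic_sum_step X Sg f x HS T M0 Mf Mx alpha eta); lra || assumption)
     (flow_defect_limit s t Hst HtT).
  rewrite nrm_X0 /= in H. apply: Rle_trans H _. apply Req_le. field. lra.
Qed.

Lemma forcing_bound :
  exists C, 0 <= C /\ forall t, 0 <= t <= T -> norm (f t) <= C.
Proof.
  case: (sa_embedding HSA (a := alpha) (b := 0)); try lra.
  move=> c [Hc H]. exists (c * K). split; first by apply Rmult_le_pos; lra.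
  move=> t Ht. case: (HfK t Ht) => Ht1 Ht2. case: (H _ Ht1) => _. rewrite nrm_X0 => H1.
  apply: Rle_trans H1 _. apply Rmult_le_compat_l; lra.
Qed.

Lemma flow_defect_small :
  exists C, 0 <= C /\ forall s t, 0 <= s < t -> t <= T ->
    norm (flow_defect s t) <= C * Rpower (t - s) eta.
Proof.
  case: semigroup_bound => M0 [HM0 HSb]. case: forcing_bound => Cf [HCf Hfb].
  case: flow_defect_sewing => C [HC HD].
  exists (C * Rpower T alpha + Mx * (M0 * Cf)). split.
  { apply Rplus_le_le_0_compat; apply Rmult_le_pos => //; first apply Rpower_nonneg.
    by apply Rmult_le_pos. }
  move=> s t Hst HtT.
  have -> : flow_defect s t =
    plus (minus (flow_defect s t) (scal (x t - x s) (Sg (t - s) (f s))))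
         (scal (x t - x s) (Sg (t - s) (f s))) by abelian.
  have H1 : norm (Sg (t - s) (f s)) <= M0 * Cf.
  { apply: Rle_trans (HSb _ _ _) _; first lra. apply Rmult_le_compat_l => //.
    apply Hfb. lra. }
  apply: Rle_trans (norm_plus_bound _ _ _ _ _ (HD s t Hst HtT)
    (norm_scal_bound _ _ _ _ _ (Hx s t Hst HtT) H1)) _.
  rewrite Rpower_plus.
  have H2 : Rpower (t - s) alpha <= Rpower T alpha by apply Rle_Rpower_l; lra.
  have H3 := Rmult_le_compat_r _ _ _ (Rmult_le_pos _ _ HC (Rpower_nonneg (t - s) eta)) H2.
  lra.
Qed.

Lemma flow_defect_chasles (s u t : R) :
  s <= u <= t -> minus (flow_defect s t) (flow_defect u t) = Sg (t - u) (flow_defect s u).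
Proof.
  move=> H. have HL : is_linear (Sg (t - u)) by apply (semigroup_bounded HS); lra.
  rewrite /flow_defect (linear_minus _ _ _ HL) -(semigroup_plus HS); try lra.
  have -> : t - u + (u - s) = t - s by ring. abelian.
Qed.

(** The leading term of the defect is smoothed from [X_alpha], the sewing remainder
    from [X_0]; both gains leave the same positive power of the length. *)
Lemma flow_defect_half :
  exists C, 0 <= C /\ forall s t, 0 <= s < t -> t <= T ->
    nrm 1 (Sg (t - (s + t) / 2) (flow_defect s ((s + t) / 2))) <=
      C * Rpower (t - s) (alpha + eta - 1).
Proof.
  case: flow_defect_sewing => C [HC HD].
  case: (sa_smoothing HSA HT (zeta := alpha) (a := 1)); try lra. move=> M1 [HM1 H1].
  case: (sa_smoothing HSA HT (zeta := 0) (a := 1)); try lra. move=> M2 [HM2 H2].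
  have HB := sa_banach HSA (a := 1) ltac:(lra).
  exists (Mx * (M1 * K) + M2 * C). split.
  { apply Rplus_le_le_0_compat; apply Rmult_le_pos; try lra. apply Rmult_le_pos; lra. }
  move=> s t Hst HtT. set u := (s + t) / 2.
  have Hu : t - u = (t - s) / 2 by rewrite /u; field.
  have Hu' : u - s = (t - s) / 2 by rewrite /u; field.
  have HL : is_linear (Sg (t - u)) by apply (semigroup_bounded HS); lra.
  set rem := minus (flow_defect s u) (scal (x u - x s) (Sg (u - s) (f s))).
  have -> : Sg (t - u) (flow_defect s u) =
    plus (scal (x u - x s) (Sg (t - s) (f s))) (Sg (t - u) rem).
  { rewrite /rem (linear_minus _ (flow_defect s u) _ HL) (linear_scal _ HL) -(semigroup_plus HS); try lra.
    have -> : t - u + (u - s) = t - s by ring. abelian. }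
  have [Hfs HfsK] := HfK s ltac:(lra).
  have [A1 B1] := H1 (t - s) ltac:(lra) _ Hfs.
  have [A2 B2] := H2 (t - u) ltac:(lra) rem (in_X0 _). rewrite nrm_X0 in B2.
  apply: Rle_trans (banach_norm_plus HB (subspace_scal (banach_subspace_linear HB) _ A1) A2) _.
  rewrite (banach_norm_scal HB _ A1).
  have E0 : Rpower (t - s) eta * Rpower (t - s) (- 1 + alpha) =
            Rpower (t - s) (alpha + eta - 1).
  { rewrite -Rpower_plus. f_equal. ring. }
  have I1 : Rabs (x u - x s) * nrm 1 (Sg (t - s) (f s)) <=
            Mx * (M1 * K) * Rpower (t - s) (alpha + eta - 1).
  { have -> : Mx * (M1 * K) * Rpower (t - s) (alpha + eta - 1) =
      Mx * Rpower (t - s) eta * (M1 * Rpower (t - s) (- 1 + alpha) * K).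
    { rewrite -E0. ring. }
    apply Rmult_le_compat; first by apply Rabs_pos.
    - apply: scale_norm_nonneg A1. lra.
    - apply: Rle_trans (Hx s u ltac:(lra) ltac:(lra)) _.
      apply Rmult_le_compat_l => //. apply Rle_Rpower_l; lra.
    - apply: Rle_trans B1 _. apply Rmult_le_compat_l => //.
      apply Rmult_le_pos; first lra. apply Rpower_nonneg. }
  have I2 : nrm 1 (Sg (t - u) rem) <= M2 * C * Rpower (t - s) (alpha + eta - 1).
  { apply: Rle_trans B2 _.
    have H3 := HD s u ltac:(lra) ltac:(lra). rewrite -/rem in H3.
    have Hp : 0 <= M2 * Rpower (t - u) (- 1 + 0).
    { apply Rmult_le_pos; first lra. apply Rpower_nonneg. }
    apply: Rle_trans (Rmult_le_compat_l _ _ _ Hp H3) _.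
    have -> : M2 * Rpower (t - u) (- 1 + 0) * (C * Rpower (u - s) (alpha + eta)) =
      M2 * C * Rpower ((t - s) / 2) (alpha + eta - 1).
    { rewrite Hu Hu'.
      have -> : alpha + eta - 1 = (- 1 + 0) + (alpha + eta) by ring.
      rewrite [in RHS]Rpower_plus. ring. }
    apply Rmult_le_compat_l; first by apply Rmult_le_pos; lra.
    apply Rle_Rpower_l; lra. }
  lra.
Qed.

(** The defects over [s,t] and over the halves [u_k,t], [u_k = t - (t - s) / 2^k],
    differ by terms of [X_1] that decrease geometrically, while the defects over
    [u_k,t] themselves tend to zero in [X] only. *)
Lemma flow_defect_X1 :
  exists C, 0 <= C /\ forall s t, 0 <= s < t -> t <= T ->
    Xs 1 (flow_defect s t) /\
    nrm 1 (flow_defect s t) <= C * Rpower (t - s) (alpha + eta - 1).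
Proof.
  case: flow_defect_half => C [HC Hhalf]. case: flow_defect_small => C0 [HC0 Hsm].
  set r := Rpower (/ 2) (alpha + eta - 1).
  have Hr : 0 < r < 1 by apply Rpower_half_lt_1; lra.
  exists (C / (1 - r)). split; first by apply Rdiv_le_0_compat; lra.
  move=> s t Hst HtT.
  set u := fun k => t - (t - s) * (/ 2) ^ k.
  have Hu : forall k, s <= u k < t.
  { move=> k. rewrite /u.
    have H1 : 0 < (/ 2) ^ k by apply pow_lt; lra.
    have H2 : (/ 2) ^ k <= 1 by rewrite -(pow1 k); apply pow_incr; lra.
    have := Rmult_lt_0_compat (t - s) _ ltac:(lra) H1.
    have := Rmult_le_compat_l (t - s) _ _ ltac:(lra) H2. lra. }
  have HuS : forall k, u (S k) = (u k + t) / 2 by move=> k; rewrite /u /=; field.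
  case: (sa_embedding HSA (a := 1) (b := 0)); try lra. move=> c0 [Hc0 Hemb].
  have Hin : forall n, Xs 1 (minus (flow_defect s t) (flow_defect (u n) t)).
  { move=> n. have Hn := Hu n. rewrite flow_defect_chasles; last lra.
    apply (sa_X1 HSA). apply smoothing_domain. lra. }
  have Hinc : forall n, nrm 1 (minus (minus (flow_defect s t) (flow_defect (u (S n)) t))
      (minus (flow_defect s t) (flow_defect (u n) t))) <=
      C * Rpower (t - s) (alpha + eta - 1) * r ^ n.
  { move=> n. have Hn := Hu n. have Hn' := Hu (S n).
    have -> : minus (minus (flow_defect s t) (flow_defect (u (S n)) t))
      (minus (flow_defect s t) (flow_defect (u n) t)) =
      minus (flow_defect (u n) t) (flow_defect (u (S n)) t) by abelian.
    rewrite flow_defect_chasles; last by rewrite HuS; lra.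
    rewrite HuS. apply: Rle_trans (Hhalf (u n) t ltac:(lra) HtT) _.
    have -> : t - u n = (t - s) * (/ 2) ^ n by rewrite /u; ring.
    rewrite Rpower_half_pow; last lra. rewrite -/r. lra. }
  have Hlim : forall eps, 0 < eps -> exists n0, forall n, (n0 <= n)%nat ->
     norm (minus (minus (flow_defect s t) (flow_defect (u n) t)) (flow_defect s t)) < eps.
  { move=> eps He. case: (Rpower_small C0 eta eps HC0 Heta He) => d [Hd Hdb].
    case: (pow_half_small (t - s) d ltac:(lra) Hd) => n0 Hn0. exists n0 => n Hn.
    have -> : minus (minus (flow_defect s t) (flow_defect (u n) t)) (flow_defect s t) =
      opp (flow_defect (u n) t) by abelian.
    have Hn1 := Hu n.
    apply: Rle_lt_trans (norm_opp_bound _ _ _ (Hsm (u n) t ltac:(lra) HtT)) _.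
    apply Hdb. have := Hn0 n Hn. rewrite /u in Hn1 |- *. lra. }
  have HCp := Rmult_le_pos _ _ HC (Rpower_nonneg (t - s) (alpha + eta - 1)).
  have Hemb' : forall z, Xs 1 z -> norm z <= c0 * nrm 1 z.
  { move=> z Hz. rewrite -nrm_X0. by apply Hemb. }
  have [D1 D2] := geometric_limit X (Xs 1) (nrm 1) (sa_banach HSA (a := 1) ltac:(lra)) c0
    _ r _ _ Hemb' HCp Hr Hin Hinc Hlim.
  split=> //.
  have E0 : minus (flow_defect s t)
      (minus (flow_defect s t) (flow_defect (u 0%nat) t)) = flow_defect s t.
  { have -> : u 0%nat = s by rewrite /u /=; ring. abelian. }
  rewrite E0 in D2. apply: Rle_trans D2 _. apply Req_le. field. lra.
Qed.

Lemma generator_flow_defect :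
  exists C, 0 <= C /\ forall s t, 0 <= s < t -> t <= T ->
    DA (flow_defect s t) /\
    norm (A (flow_defect s t)) <= C * Rpower (t - s) (alpha + eta - 1).
Proof.
  case: flow_defect_X1 => C [HC H]. case: (sa_X1_norm HSA) => c [Hc Hn].
  exists (c * C). split; first by apply Rmult_le_pos; lra.
  move=> s t Hst HtT. case: (H s t Hst HtT) => H1 H2.
  have HD : DA (flow_defect s t) by apply (sa_X1 HSA).
  split=> //. case: (Hn _ HD) => _ H3.
  have H4 : 0 <= norm (flow_defect s t) by apply: norm_ge_0.
  have := Rmult_le_compat_l c _ _ (Rlt_le _ _ Hc) H2. lra.
Qed.

Lemma solution_split (s t : R) : y t = plus (Sg (t - s) (y s)) (flow_defect s t).
Proof. rewrite /flow_defect. abelian. Qed.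

Lemma generator_split (s t : R) : 0 <= s < t -> t <= T ->
  A (y t) = plus (A (Sg (t - s) (y s))) (A (flow_defect s t)).
Proof.
  move=> Hst HtT. case: generator_flow_defect => C [_ H]. case: (H s t Hst HtT) => HD _.
  rewrite {1}(solution_split s t). apply (operator_plus (sa_operator HSA)) => //.
  apply smoothing_domain. lra.
Qed.

(** The initial datum is only in [X_alpha]; smoothing it into [X_1] costs
    [t^(alpha-1)], which is integrable at [0] and dominates the defect. *)
Lemma solution_domain :
  exists C, 0 <= C /\ forall t, 0 < t <= T ->
    DA (y t) /\ norm (A (y t)) <= C * Rpower t (alpha - 1).
Proof.
  case: generator_flow_defect => C [HC H].
  case: (sa_smoothing HSA HT (zeta := alpha) (a := 1)); try lra. move=> M1 [HM1 H1].
  case: (sa_X1_norm HSA) => c [Hc Hn].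
  have Hn0 : 0 <= nrm alpha (y 0) by apply scale_norm_nonneg => //; lra.
  exists (c * (M1 * nrm alpha (y 0)) + C * Rpower T eta). split.
  { apply Rplus_le_le_0_compat.
    - apply Rmult_le_pos; first lra. apply Rmult_le_pos; lra.
    - apply Rmult_le_pos => //. apply Rpower_nonneg. }
  move=> t Ht. case: (H 0 t ltac:(lra) ltac:(lra)) => HD HDb.
  have HDS : DA (Sg (t - 0) (y 0)) by apply smoothing_domain; lra.
  split.
  - rewrite (solution_split 0 t).
    by apply (subspace_plus (operator_domain (sa_operator HSA))).
  - rewrite (generator_split 0 t); try lra.
    rewrite Rminus_0_r in HDS HDb |- *.
    have [_ B1] := H1 t Ht _ Hy0. have [_ B2] := Hn _ HDS.
    have E1 : - (1) + alpha = alpha - 1 by ring. rewrite E1 in B1.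
    have H4 : 0 <= norm (Sg t (y 0)) by apply: norm_ge_0.
    have B3 : norm (A (Sg t (y 0))) <= c * (M1 * Rpower t (alpha - 1) * nrm alpha (y 0)).
    { have := Rmult_le_compat_l c _ _ (Rlt_le _ _ Hc) B1. lra. }
    apply: Rle_trans (norm_plus_bound _ _ _ _ _ B3 HDb) _.
    have -> : alpha + eta - 1 = eta + (alpha - 1) by ring.
    rewrite Rpower_plus.
    have H5 : Rpower t eta <= Rpower T eta by apply Rle_Rpower_l; lra.
    have H6 := Rmult_le_compat_r _ _ _
      (Rmult_le_pos _ _ HC (Rpower_nonneg t (alpha - 1))) H5.
    lra.
Qed.

(** [A y] stopped at time [T], so that continuity at [T] can be two-sided. *)
Definition generator_path (u : R) : X := A (y (Rmin u T)).

Lemma generator_path_eq (u : R) : u <= T -> generator_path u = A (y u).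
Proof. move=> Hu. by rewrite /generator_path Rmin_left. Qed.

(** At distance [d] from [u] the path is an orbit of the generator, continuous at
    positive times, up to a defect of order [d^(alpha+eta-1)]. *)
Lemma generator_path_continuous (u : R) : 0 < u -> continuous generator_path u.
Proof.
  move=> Hu. apply (proj2 (filterlim_locally_norm_iff X (locally u) _ _)) => eps He.
  case: generator_flow_defect => C [HC HD].
  have He4 : 0 < eps / 4 by lra.
  have Hg : 0 < alpha + eta - 1 by lra.
  case: (Rpower_small C _ _ HC Hg He4) => d [Hd Hdb].
  set w := Rmin u T. have Hw : 0 < w by apply Rmin_glb_lt.
  have HwT : w <= T by apply Rmin_r.
  have Hm : 0 < Rmin d w by apply Rmin_glb_lt.
  have Hm1 := Rmin_l d w. have Hm2 := Rmin_r d w.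
  set e := Rmin d w / 3. have Ee : e = Rmin d w / 3 by [].
  have He0 : 0 < e by lra.
  set s := w - e. have Hs : 0 < s by rewrite /s /e; lra.
  have [_ Hc] := orbit_derivative X DA A Sg HS (sa_generates HSA) (y s)
    ltac:(move=> r Hr; by apply smoothing_domain) e He0.
  case: (proj1 (filterlim_locally_norm_iff X (locally e) _ _) Hc _ He4) => d2 Hd2.
  have Hm' : 0 < Rmin d2 e by apply Rmin_glb_lt => //; apply cond_pos.
  have Hm1' := Rmin_l d2 e. have Hm2' := Rmin_r d2 e.
  exists (mkposreal _ Hm') => u'.
  rewrite /ball /= /AbsRing_ball /abs /minus /plus /opp /= => Hu'.
  have [Hu1 Hu2] := Rabs_def2 _ _ Hu'.
  set w' := Rmin u' T.
  have HwT' : w' <= T by apply Rmin_r.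
  have Hww : - Rmin d2 e < w' - w < Rmin d2 e.
  { rewrite /w /w' /Rmin in Hu1 Hu2 |- *.
    case: (Rle_dec u T); case: (Rle_dec u' T); lra. }
  have Hes : e = w - s by rewrite /s; ring.
  rewrite /generator_path -/w -/w'.
  rewrite (generator_split s w') /s; try lra.
  rewrite (generator_split s w) /s; try lra. rewrite -/s -Hes.
  have [_ B1] := HD s w' ltac:(lra) HwT'. have [_ B2] := HD s w ltac:(lra) HwT.
  have B1' := Hdb (w' - s) ltac:(lra).
  have B2' := Hdb (w - s) ltac:(lra).
  have B3 : norm (minus (A (Sg (w' - s) (y s))) (A (Sg e (y s)))) < eps / 4.
  { apply (Hd2 (w' - s)). rewrite /ball /= /AbsRing_ball /abs /minus /plus /opp /=.
    apply Rabs_def1; lra. }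
  have E : minus (plus (A (Sg (w' - s) (y s))) (A (flow_defect s w')))
                 (plus (A (Sg e (y s))) (A (flow_defect s w))) =
    plus (minus (A (Sg (w' - s) (y s))) (A (Sg e (y s))))
         (minus (A (flow_defect s w')) (A (flow_defect s w))) by abelian.
  change (norm (minus (plus (A (Sg (w' - s) (y s))) (A (flow_defect s w')))
                 (plus (A (Sg e (y s))) (A (flow_defect s w)))) < eps).
  rewrite E.
  apply: Rle_lt_trans (norm_plus_bound _ _ _ _ _ (Rlt_le _ _ B3)
           (norm_minus_bound _ _ _ _ _ B1 B2)) _.
  lra.
Qed.

Lemma smoothing_continuous_0 (v : X) :
  Xs alpha v -> forall eps, 0 < eps ->
  exists d, 0 < d /\ forall e, 0 < e < d -> norm (minus (Sg e v) v) < eps.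
Proof.
  move=> Hv eps He.
  case: (sa_increment HSA HT (m := alpha) (n := 0)); try lra. move=> C [HC H].
  have Hn : 0 <= nrm alpha v by apply scale_norm_nonneg => //; lra.
  case: (Rpower_small (C * nrm alpha v) alpha eps) => //; try lra.
  { apply Rmult_le_pos; lra. }
  move=> d [Hd Hdb]. exists (Rmin d T). split; first by apply Rmin_glb_lt.
  have H1 := Rmin_l d T. have H2 := Rmin_r d T.
  move=> e He'. have := H e ltac:(lra) v Hv. rewrite nrm_X0 Rminus_0_r.
  have := Hdb e ltac:(lra). lra.
Qed.

Lemma solution_in_scale (t : R) : 0 <= t <= T -> Xs alpha (y t).
Proof.
  move=> Ht. case: (Req_dec t 0) => [->|Ht0] //.
  case: solution_domain => C [_ H]. case: (H t ltac:(lra)) => HD _.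
  apply (sa_X1 HSA) in HD.
  case: (sa_embedding HSA (a := 1) (b := alpha)); try lra.
  move=> c [_ Hc]. by case: (Hc _ HD).
Qed.

(** Over [s+e,t] the path [A y(u)] is [A S(u-s) y(s)], an exact derivative, plus the
    generator applied to a small defect; the limit [e -> 0] only needs the
    continuity of the orbit and of [G] at their starting points, not that of their
    derivatives. *)
Lemma solution_minus_primitive :
  exists C, 0 <= C /\ forall G, singular_primitive X T generator_path G ->
  forall s t, 0 <= s < t -> t <= T ->
    norm (minus (minus (minus (y t) (G t)) (minus (y s) (G s))) (flow_defect s t)) <=
      C * Rpower (t - s) (alpha + eta).
Proof.
  case: generator_flow_defect => C [HC HD]. exists C. split=> // G HG s t Hst HtT.
  apply le_epsilon => eps He.
  have He2 : 0 < eps / 2 by lra.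
  case: (smoothing_continuous_0 (y s) (solution_in_scale s ltac:(lra)) _ He2) => d1 [Hd1 H1].
  case: (proj1 (filterlim_locally_norm_iff X (at_right s) _ _)
               (primitive_right _ _ _ _ HG s ltac:(lra)) _ He2) => d2 Hd2.
  have Hm : 0 < Rmin (Rmin d1 d2) (t - s).
  { apply Rmin_glb_lt; last lra. apply Rmin_glb_lt => //. apply cond_pos. }
  have Hm1 := Rmin_l (Rmin d1 d2) (t - s). have Hm2 := Rmin_r (Rmin d1 d2) (t - s).
  have Hm3 := Rmin_l d1 d2. have Hm4 := Rmin_r d1 d2.
  set e := Rmin (Rmin d1 d2) (t - s) / 2.
  have Ee : e = Rmin (Rmin d1 d2) (t - s) / 2 by [].
  have B1 : norm (minus (Sg e (y s)) (y s)) < eps / 2 by apply H1; lra.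
  have B2 : norm (minus (G (s + e)) (G s)) < eps / 2.
  { apply Hd2; last lra. rewrite /ball /= /AbsRing_ball /abs /minus /plus /opp /=.
    rewrite Rabs_pos_eq; lra. }
  have Horb : forall r, 0 < r -> is_derive (fun r => Sg r (y s)) r (A (Sg r (y s))) /\
      continuous (fun r => A (Sg r (y s))) r.
  { apply (orbit_derivative X DA A Sg HS (sa_generates HSA)) => r Hr.
    by apply smoothing_domain. }
  have Hsh : forall u, is_derive (fun u => u - s) u 1 by move=> u; auto_derive.
  have I1 := primitive_RInt _ _ _ _ HG (s + e) t ltac:(lra) HtT.
  have I2 : is_RInt (fun u => A (Sg (u - s) (y s))) (s + e) t
      (minus (Sg (t - s) (y s)) (Sg (s + e - s) (y s))).
  { apply (is_RInt_derive (fun u => Sg (u - s) (y s))) => u;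
      rewrite Rmin_left ?Rmax_right; try lra; move=> Hu.
    - rewrite -(scal_one (A (Sg (u - s) (y s)))).
      apply (is_derive_comp (fun r => Sg r (y s)) (fun u => u - s)) => //.
      apply Horb. lra.
    - apply (continuous_comp (fun u => u - s) (fun r => A (Sg r (y s)))).
      + apply: ex_derive_continuous. by exists 1.
      + apply Horb. lra. }
  have I3 := is_RInt_minus _ _ _ _ _ _ I1 I2.
  have B3 : norm (minus (minus (G t) (G (s + e)))
      (minus (Sg (t - s) (y s)) (Sg (s + e - s) (y s)))) <=
      (t - (s + e)) * (C * Rpower (t - s) (alpha + eta - 1)).
  { refine (norm_RInt_le_const _ _ _ _ _ _ _ I3); first lra.
    move=> u Hu. rewrite generator_path_eq; last lra.
    rewrite (generator_split s u); try lra.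
    have -> : minus (plus (A (Sg (u - s) (y s))) (A (flow_defect s u)))
      (A (Sg (u - s) (y s))) = A (flow_defect s u) by abelian.
    have [_ H] := HD s u ltac:(lra) ltac:(lra).
    apply: Rle_trans H _. apply Rmult_le_compat_l => //. apply Rle_Rpower_l; lra. }
  have Es : s + e - s = e by ring. rewrite Es in B3.
  have -> : minus (minus (minus (y t) (G t)) (minus (y s) (G s))) (flow_defect s t) =
    minus (minus (minus (Sg e (y s)) (y s)) (minus (G (s + e)) (G s)))
      (minus (minus (G t) (G (s + e))) (minus (Sg (t - s) (y s)) (Sg e (y s)))).
  { rewrite {1}(solution_split s t). abelian. }
  apply: Rle_trans (norm_minus_bound _ _ _ _ _
    (norm_minus_bound _ _ _ _ _ (Rlt_le _ _ B1) (Rlt_le _ _ B2)) B3) _.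
  have E : Rpower (t - s) (alpha + eta) = (t - s) * Rpower (t - s) (alpha + eta - 1).
  { rewrite -{2}(Rpower_1 (t - s)); last lra. rewrite -Rpower_plus. f_equal. ring. }
  rewrite E.
  have HCp := Rmult_le_pos _ _ HC (Rpower_nonneg (t - s) (alpha + eta - 1)).
  have H5 := Rmult_le_compat_r _ (t - (s + e)) (t - s) HCp ltac:(lra).
  lra.
Qed.

(** Three errors of the same order: the defect against its leading term
    [S(t-s) f(s)], that term against [f(s)], and the generator part. *)
Lemma young_increment :
  exists C, 0 <= C /\ forall G, singular_primitive X T generator_path G ->
  forall s t, 0 <= s < t -> t <= T ->
    norm (minus (scal (x t - x s) (f s))
                (minus (minus (y t) (G t)) (minus (y s) (G s)))) <=
      C * Rpower (t - s) (alpha + eta).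
Proof.
  case: solution_minus_primitive => C1 [HC1 H1]. case: flow_defect_sewing => C2 [HC2 H2].
  case: (sa_increment HSA HT (m := alpha) (n := 0)); try lra. move=> C3 [HC3 H3].
  exists (C1 + C2 + Mx * (C3 * K)).
  have Hp : 0 <= Mx * (C3 * K) by apply Rmult_le_pos => //; apply Rmult_le_pos; lra.
  split; first lra.
  move=> G HG s t Hst HtT.
  have B1 := H1 G HG s t Hst HtT. have B2 := H2 s t Hst HtT.
  have [Hfs HfsK] := HfK s ltac:(lra).
  have B3 : norm (minus (Sg (t - s) (f s)) (f s)) <= C3 * Rpower (t - s) alpha * K.
  { have := H3 (t - s) ltac:(lra) _ Hfs. rewrite nrm_X0 Rminus_0_r => B.
    apply: Rle_trans B _. apply Rmult_le_compat_l => //.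
    apply Rmult_le_pos; first lra. apply Rpower_nonneg. }
  set H := minus (minus (y t) (G t)) (minus (y s) (G s)) in B1 |- *.
  have -> : minus (scal (x t - x s) (f s)) H =
    opp (plus (plus (minus H (flow_defect s t))
      (minus (flow_defect s t) (scal (x t - x s) (Sg (t - s) (f s)))))
      (scal (x t - x s) (minus (Sg (t - s) (f s)) (f s)))).
  { clearbody H. rewrite scal_minus_distr_l. abelian. }
  apply: Rle_trans (norm_opp_bound _ _ _ (norm_plus_bound _ _ _ _ _
    (norm_plus_bound _ _ _ _ _ B1 B2)
    (norm_scal_bound _ _ _ _ _ (Hx s t Hst HtT) B3))) _.
  rewrite Rpower_plus. apply Req_le. ring.
Qed.

(** The exponent [alpha + eta > 1] makes the local errors negligible along every
    partition, so [y - G] is recovered as the Young integral of [f]; its existence is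
    obtained at the same time. *)
Lemma young_integral_of_increments (G : R -> X) (t : R) :
  singular_primitive X T generator_path G -> 0 <= t <= T ->
  is_young_int x f 0 t (minus (minus (y t) (G t)) (minus (y 0) (G 0))).
Proof.
  move=> HG Ht eps He. case: young_increment => C [HC HCb].
  have Hb := HCb G HG.
  have Hg : 0 < alpha + eta - 1 by lra.
  have HCT : 0 <= C * T by apply Rmult_le_pos; lra.
  case: (Rpower_small (C * T) _ _ HCT Hg He) => d [Hd Hdb].
  exists (d / 2). split; first lra. move=> n p [Hp0 [Hpn Hpi]] Hm.
  set H := fun u => minus (y u) (G u).
  set q := Rpower (d / 2) (alpha + eta - 1).
  have Hq : 0 <= q by apply Rpower_nonneg.
  have Hmono : forall k, (k <= n)%nat -> 0 <= p k.
  { elim=> [|k IH] Hk; first lra. have := Hpi k Hk. have := IH ltac:(lia). lra. }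
  have Hmono' : forall j, (j <= n)%nat -> p (n - j)%nat <= T.
  { elim=> [|j IH] Hj; first by rewrite Nat.sub_0_r; lra.
    have := IH ltac:(lia). have := Hpi (n - S j)%nat ltac:(lia).
    have -> : S (n - S j) = (n - j)%nat by lia. lra. }
  have Hind : forall k, (k <= n)%nat ->
    norm (minus (young_sum x f k p) (minus (H (p k)) (H 0))) <= C * q * p k.
  { elim=> [|k IH] Hk.
    - rewrite /young_sum sum_n_m_zero; last lia. rewrite Hp0.
      have -> : minus zero (minus (H 0) (H 0)) = zero by abelian.
      rewrite norm_zero. lra.
    - have H0 := IH ltac:(lia). have Hk0 := Hpi k ltac:(lia). have Hk1 := Hmono k ltac:(lia).
      have Hk2 := Hmono' (n - S k)%nat ltac:(lia).
      have Ek : (n - (n - S k) = S k)%nat by lia. rewrite Ek in Hk2.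
      have B := Hb (p k) (p (S k)) ltac:(lra) Hk2.
      rewrite /young_sum sum_n_Sm; last lia. rewrite -/(young_sum x f k p) /=.
      have -> : minus (plus (young_sum x f k p) (scal (x (p (S k)) - x (p k)) (f (p k))))
          (minus (H (p (S k))) (H 0)) =
        plus (minus (young_sum x f k p) (minus (H (p k)) (H 0)))
          (minus (scal (x (p (S k)) - x (p k)) (f (p k)))
             (minus (minus (y (p (S k))) (G (p (S k)))) (minus (y (p k)) (G (p k))))).
      { rewrite /H. abelian. }
      apply: Rle_trans (norm_plus_bound _ _ _ _ _ H0 B) _.
      have E : Rpower (p (S k) - p k) (alpha + eta) =
        (p (S k) - p k) * Rpower (p (S k) - p k) (alpha + eta - 1).
      { rewrite -{2}(Rpower_1 (p (S k) - p k)); last lra.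
        rewrite -Rpower_plus. f_equal. ring. }
      have Hqk : Rpower (p (S k) - p k) (alpha + eta - 1) <= q.
      { apply Rle_Rpower_l; first lra. have := Hm k ltac:(lia). lra. }
      have Hpk : 0 <= C * (p (S k) - p k) by apply Rmult_le_pos; lra.
      have := Rmult_le_compat_l _ _ _ Hpk Hqk. rewrite E. lra. }
  have := Hind n (le_n n). rewrite Hpn => B.
  have Hd2 := Hdb (d / 2) ltac:(lra). rewrite -/q in Hd2.
  have HCq : 0 <= C * q by apply Rmult_le_pos.
  have H1 := Rmult_le_compat_l _ _ _ HCq (proj2 Ht).
  apply (Rle_lt_trans _ (C * q * t)); first exact B. lra.
Qed.

Theorem forced_solution_integral_equation :
  (forall t, 0 < t <= T -> DA (y t)) /\
  (forall t, 0 <= t <= T -> exists J I : X,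
     is_int_singular (fun u => A (y u)) 0 t J /\
     is_young_int x f 0 t I /\
     y t = plus (y 0) (plus J I)).
Proof.
  case: solution_domain => C [HC Hdom].
  split; first by move=> t Ht; apply Hdom.
  have Hb : forall u, 0 < u <= T -> norm (generator_path u) <= C * Rpower u (alpha - 1).
  { move=> u Hu. rewrite generator_path_eq; last lra. by apply Hdom. }
  have Ha : 0 < alpha by lra.
  case: (singular_primitive_exists X T C alpha _ HT Ha HC generator_path_continuous Hb)
    => G HG.
  case: (singular_primitive_exists R_CompleteNormedModule T C alpha
    (fun u => norm (generator_path u)) HT Ha HC) => [u Hu|u Hu|Gn HGn].
  { apply (continuous_comp generator_path norm).
    - by apply generator_path_continuous.
    - apply: filterlim_norm. }
  { rewrite {1}/norm /= /abs /= Rabs_pos_eq; first by apply Hb. apply: norm_ge_0. }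
  move=> t Ht. exists (G t), (minus (minus (y t) (G t)) (minus (y 0) (G 0))).
  have Hext : 0 < t -> filter_prod (at_right 0) (at_point t) (fun ab : R * R =>
      forall u, Rmin (fst ab) (snd ab) < u < Rmax (fst ab) (snd ab) -> u <= T).
  { move=> Ht0. apply (Filter_prod _ _ _ (fun a => a < t) (fun b => b = t)) => //.
    - exists (mkposreal _ Ht0) => a.
      rewrite /ball /= /AbsRing_ball /abs /minus /plus /opp /= => Hat _.
      have := Rabs_def2 _ _ Hat. lra.
    - move=> a b Hab -> u /= [_ Hu]. rewrite Rmax_right in Hu; lra. }
  split; [|split].
  - case: (Req_dec t 0) => [->|Ht0].
    { left. split=> //. apply (primitive_0 _ _ _ _ HG). }
    right. have Htp : 0 < t by lra. split=> //. split; [|split].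
    + move=> u Hu.
      have Hg := generator_path_continuous u ltac:(lra).
      rewrite -(generator_path_eq u); last lra.
      apply (filterlim_within_ext (F := locally u) _ generator_path).
      { move=> v Hv. apply generator_path_eq. lra. }
      apply: filterlim_filter_le_1 Hg. apply filter_le_within.
    + exists (Gn t). apply (is_RInt_gen_ext (fun u => norm (generator_path u))).
      * apply: filter_imp (Hext Htp) => ab Hab u Hu. rewrite generator_path_eq //. by apply Hab.
      * exact (singular_primitive_RInt_gen R_CompleteNormedModule T t _ Gn HGn
                 (conj Htp (proj2 Ht))).
    + apply (is_RInt_gen_ext generator_path).
      * apply: filter_imp (Hext Htp) => ab Hab u Hu. rewrite generator_path_eq //. by apply Hab.
      * exact (singular_primitive_RInt_gen X T t _ G HG (conj Htp (proj2 Ht))).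
  - by apply young_integral_of_increments.
  - rewrite (primitive_0 _ _ _ _ HG). abelian.
Qed.

End ForcedEquation.

(** * The nonlinear equation *)

Theorem theorem4p4 :
  forall (X : CompleteNormedModule R_AbsRing)
         (DA : X -> Prop) (A : X -> X) (Sg : R -> X -> X)
         (Xs : R -> X -> Prop) (nrm : R -> X -> R)
         (T : R) (x : R -> R) (eta alpha : R)
         (sigma : X -> X) (psi : X) (y : R -> X),
    0 < T ->
    structural_assumptions DA A Sg Xs nrm ->
    1 / 2 < eta < 1 ->
    holder eta 0 T x ->
    0 < alpha < 1 ->
    alpha + eta > 1 ->
    sigma_assumptions Xs nrm alpha sigma ->
    Xs alpha psi ->
    mild_solution Sg Xs nrm T alpha x sigma psi y ->
    C_hat Sg Xs nrm alpha alpha 0 T y ->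
    (forall t, 0 < t <= T -> DA (y t)) /\
    (forall t, 0 <= t <= T -> exists J K : X,
       is_int_singular (fun u => A (y u)) 0 t J /\
       is_young_int x (fun u => sigma (y u)) 0 t K /\
       y t = plus psi (plus J K)).
Proof.
  move=> X DA A Sg Xs nrm T x eta alpha sigma psi y.
  move=> HT HSA Heta [Mx Hx] Halpha Hsum Hsigma Hpsi.
  move=> [[_ [_ [Mf Hf]]] Hmild] [Hycont [_ [My Hy]]].
  have HS := sa_semigroup HSA.
  have Ey0 : y 0 = psi.
  { case: (Hmild 0 ltac:(lra)) => I [HI ->]. rewrite (semigroup_0 HS).
    have -> : I = zero.
    { symmetry. apply eq_of_norm_small => eps He. case: (HI _ He) => d [Hd Hs].
      have := Hs 0%nat (fun _ => 0). rewrite /young_sum sum_n_m_zero; last lia.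
      move=> H. apply Rlt_le, H; [split=> //; split=> // i Hi; lia | move=> i Hi; lia]. }
    by rewrite plus_zero_r. }
  have HyX : forall t, 0 <= t <= T -> Xs alpha (y t).
  { move=> t Ht. by case: (Hycont t Ht). }
  have HB := sa_banach HSA (a := alpha) ltac:(lra).
  (* Boundedness of [y] in [X_alpha] is read off the defect started at [0]. *)
  case: (sa_smoothing HSA HT (zeta := alpha) (a := alpha)); try lra. move=> M [HM HMb].
  set Y := M * nrm alpha psi + Rabs My * Rpower T alpha + nrm alpha psi.
  have Hn : 0 <= nrm alpha psi by apply (scale_norm_nonneg X DA A Sg Xs nrm HSA) => //; lra.
  have HMT : 0 <= Rabs My * Rpower T alpha.
  { apply Rmult_le_pos; [apply Rabs_pos | apply Rpower_nonneg]. }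
  have HMn : 0 <= M * nrm alpha psi by apply Rmult_le_pos; lra.
  have HyY : forall t, 0 <= t <= T -> nrm alpha (y t) <= Y.
  { move=> t Ht. case: (Req_dec t 0) => [->|Ht0]; first by rewrite Ey0 /Y; lra.
    have H := Hy (0, t) ltac:(rewrite /simplex /=; lra).
    rewrite /delta_hat /= Rminus_0_r Ey0 in H.
    case: (HMb t ltac:(lra) _ Hpsi) => D1 D2.
    have E0 : - alpha + alpha = 0 by ring. rewrite E0 Rpower_O in D2; last lra.
    have -> : y t = plus (Sg t psi) (minus (y t) (Sg t psi)) by abelian.
    have D3 : Xs alpha (minus (y t) (Sg t psi)).
    { apply (subspace_minus X _ _ HB) => //. by apply HyX. }
    apply: Rle_trans (banach_norm_plus HB D1 D3) _.
    have Hp : 0 < Rpower t alpha by apply exp_pos.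
    have H4 : nrm alpha (minus (y t) (Sg t psi)) <= My * Rpower t alpha.
    { have := Rmult_le_compat_r _ _ _ (Rlt_le _ _ Hp) H.
      rewrite /Rdiv Rmult_assoc Rinv_l ?Rmult_1_r //. lra. }
    have H5 : My * Rpower t alpha <= Rabs My * Rpower T alpha.
    { apply: (Rle_trans _ (Rabs My * Rpower t alpha)).
      - apply Rmult_le_compat_r; [lra | apply Rle_abs].
      - apply Rmult_le_compat_l; [apply Rabs_pos | apply Rle_Rpower_l; lra]. }
    rewrite /Y. lra. }
  case: (sigma_growth Hsigma) => L [HL HLb].
  have HK : 0 <= L * (1 + Y) by apply Rmult_le_pos; rewrite /Y; lra.
  rewrite -Ey0.
  apply (forced_solution_integral_equation X DA A Sg Xs nrm T x eta alpha
    (fun t => sigma (y t)) y (L * (1 + Y)) (Rabs Mf) (Rabs Mx)) => //; try lra;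
    try apply Rabs_pos.
  - move=> s t Hst HtT. apply: Rle_trans (Hx s t _ _ HtT) _; try lra.
    apply Rmult_le_compat_r; [apply Rpower_nonneg | apply Rle_abs].
  - move=> t Ht. split; first by apply (sigma_stable Hsigma), HyX.
    apply: Rle_trans (HLb _ (HyX t Ht)) _. apply Rmult_le_compat_l; first lra.
    have := HyY t Ht. lra.
  - move=> s t Hst HtT.
    have H := Hf (s, t) ltac:(rewrite /simplex /=; lra).
    rewrite /delta_hat /= (nrm_X0 X DA A Sg Xs nrm HSA) in H.
    have Hp : 0 < Rpower (t - s) alpha by apply exp_pos.
    have := Rmult_le_compat_r _ _ _ (Rlt_le _ _ Hp) H.
    rewrite /Rdiv Rmult_assoc Rinv_l ?Rmult_1_r; last lra. move=> B.
    apply: Rle_trans B _. apply Rmult_le_compat_r; [lra | apply Rle_abs].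
  - by rewrite Ey0.
  - move=> t Ht. case: (Hmild t Ht) => I [HI E]. exists I. by rewrite Ey0.
Qed.
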